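(* Let $A\in\mathrm{SL}_d(\mathbb{A}_f)$, let $\mathcal{W}\subset\mathbb{A}_f^d$ be a bounded Borel set with $m_f(\partial\mathcal{W})=0$ and $m_f(\mathcal{W})>0$, let $\bm\alpha\in\mathbb{R}^d$ and $c\in[0,1)$. For $\sigma>0$ and $r\in\mathbb{Z}_{\ge0}$ define $$G_{\mathcal{P},\bm\alpha,c}(\sigma,r)=\mu_{\mathrm{ASL}_d(\mathbb{Q})\backslash\mathrm{ASL}_d(\mathbb{A})}\big(\{M : \#(\mathcal{P}(\delta(\mathbb{Q})^dM,\mathcal{W})\cap\mathscr{K}_{c,\sigma})=r\}\big)\quad\text{if }\bm\alpha\notin\mathbb{Q}^d,$$ $$G_{\mathcal{P},\bm\alpha,c}(\sigma,r)=\mu_{\mathrm{SL}_d(\mathbb{Q})\backslash\mathrm{SL}_d(\mathbb{A})}\big(\{M : \#(\mathcal{P}(\delta(\mathbb{Q})^dM,\mathcal{W}_{\bm\beta})\cap\mathscr{K}_{c,\sigma})=r\}\big)\quad\text{if }\bm\alpha\in\mathbb{Q}^d,$$ where in the second case $\bm\beta\in\delta(\mathbb{Q})^d$ satisfies $\bm\alpha=\pi(\bm\beta)$ and $\mathcal{W}_{\bm\beta}=\mathcal{W}-\pi_{\mathrm{int}}(\bm\beta)A_f$. Then for every $r\in\mathbb{Z}_{\ge0}$, the function $\sigma\mapsto G_{\mathcal{P},\bm\alpha,c}(\sigma,r)$ is continuous on $(0,\infty)$.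
   Context: $d\ge2$. $\mathbb{A}=\mathbb{R}\times\mathbb{A}_f$ is the ring of adeles of $\mathbb{Q}$, $\mathbb{A}^d=\mathbb{R}^d\times\mathbb{A}_f^d$, with canonical projections $\pi\colon\mathbb{A}^d\to\mathbb{R}^d$, $\pi_{\mathrm{int}}\colon\mathbb{A}^d\to\mathbb{A}_f^d$; $A\in\mathrm{SL}_d(\mathbb{A}_f)$ is regarded as the element of $\mathrm{SL}_d(\mathbb{A})$ with identity real component, and $A_f=A$. $\delta$ is the diagonal embedding of $\mathbb{Q}^d$ into $\mathbb{A}^d$. $\mathrm{ASL}_d(\mathbb{A})=\mathrm{SL}_d(\mathbb{A})\ltimes\mathbb{A}^d$ acts on row vectors on the right by $\bm x(M,\bm\zeta)=\bm xM+\bm\zeta$. For a discrete set $\mathcal{L}\subset\mathbb{A}^d$ and bounded $\mathcal{W}\subset\mathbb{A}_f^d$, $\mathcal{P}(\mathcal{L},\mathcal{W})=\{\pi(\bm x):\bm x\in\mathcal{L},\ \pi_{\mathrm{int}}(\bm x)\in\mathcal{W}\}$. $m_f$ is the Haar measure on $\mathbb{A}_f^d$ (normalized with $m_f(\widehat{\mathbb{Z}}^d)=1$). The measures $\mu$ are the invariant probability measures on the indicated quotients. $\mathcal{B}^{d-1}$ is the unit ball in $\mathbb{R}^{d-1}$ and $$\mathscr{K}_{c,\sigma}=\Big\{(x_1,\ldots,x_d)\in\mathbb{R}^d : c<x_1<1,\ \|(x_2,\ldots,x_d)\|_2\le\Big(\tfrac{\sigma d}{(1-c^d)m_f(\mathcal{W})\mathrm{vol}(\mathcal{B}^{d-1})}\Big)^{1/(d-1)}x_1\Big\}.$$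 *)

(* Defs.v *)
From HB Require Import structures.
From mathcomp Require Import all_boot all_order all_algebra.
From mathcomp Require Import all_classical all_reals all_analysis.

Set Implicit Arguments.
Unset Strict Implicit.
Unset Printing Implicit Defensive.

Import Order.TTheory GRing.Theory Num.Theory.
Import numFieldNormedType.Exports.

Local Open Scope classical_set_scope.
Local Open Scope ring_scope.

Definition primeT := {p : nat | prime p}.
HB.instance Definition _ := Countable.on primeT.

Definition padic_norm (p : nat) (x : rat) : rat :=
  if x == 0 then 0
  else p%:R ^ ((logn p `|denq x|%N)%:Z - (logn p `|numq x|%N)%:Z).

Section padic_norm_theory.
Variable p : primeT.
Let q := val p.
Let pr_q : prime q := valP p.
Local Notation norm := (padic_norm q).

Lemma padic_p_gt0 : 0 < q%:R :> rat.
Proof. by rewrite ltr0n prime_gt0. Qed.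

Lemma padic_p_gt1 : 1 < q%:R :> rat.
Proof. by rewrite ltr1n prime_gt1. Qed.

Lemma padic_norm0 : norm 0 = 0.
Proof. by rewrite /padic_norm eqxx. Qed.

Lemma padic_norm_ge0 x : 0 <= norm x.
Proof.
by rewrite /padic_norm; case: ifP => // _; rewrite exprz_ge0 // ltW ?padic_p_gt0.
Qed.

Lemma padic_norm_eq0 x : (norm x == 0) = (x == 0).
Proof.
rewrite /padic_norm; case: (eqVneq x 0) => // _.
by apply/negbTE; rewrite expfz_neq0 // gt_eqF ?padic_p_gt0.
Qed.

Lemma padic_norm_frac (a b : int) : a != 0 -> b != 0 ->
  norm (a%:Q / b%:Q) = q%:R ^ ((logn q `|b|%N)%:Z - (logn q `|a|%N)%:Z).
Proof.
move=> a0 b0; set x := _ / _.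
have x0 : x != 0 by rewrite mulf_neq0 ?invr_eq0 ?intr_eq0.
rewrite /padic_norm (negPf x0); congr (_ ^ _).
have eqx : numq x * b = a * denq x.
  have xb : x * b%:Q = a%:Q by rewrite divfK ?intr_eq0.
  by apply: (@intr_inj rat); rewrite !intrM numqE mulrAC xb.
have n0 : numq x != 0 by rewrite numq_eq0.
have d0 : denq x != 0 by rewrite denq_eq0.
have := congr1 (fun z : int => logn q `|z|%N) eqx.
rewrite !abszM !lognM ?absz_gt0 // => e.
by apply/eqP; rewrite subr_eq addrAC eq_sym subr_eq -!PoszD eqz_nat; apply/eqP; rewrite addnC e addnC.
Qed.

Lemma padic_normM x y : norm (x * y) = norm x * norm y.
Proof.
have [->|x0] := eqVneq x 0; first by rewrite mul0r padic_norm0 mul0r.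
have [->|y0] := eqVneq y 0; first by rewrite mulr0 padic_norm0 mulr0.
have -> : x * y = (numq x * numq y)%:Q / (denq x * denq y)%:Q.
  by rewrite -{1}[x]divq_num_den -{1}[y]divq_num_den mulf_div -!intrM.
rewrite padic_norm_frac ?mulf_neq0 ?numq_eq0 ?denq_eq0 //.
rewrite /padic_norm (negPf x0) (negPf y0) -expfzDr ?gt_eqF ?padic_p_gt0 //.
congr (_ ^ _); rewrite !abszM !lognM ?absz_gt0 ?numq_eq0 ?denq_eq0 //.
by rewrite !PoszD opprD addrACA.
Qed.

Lemma padic_norm1 : norm 1 = 1.
Proof. by rewrite /padic_norm oner_eq0 /= logn1 subrr expr0z. Qed.

Lemma padic_normN x : norm (- x) = norm x.
Proof.
by rewrite /padic_norm oppr_eq0 denqN numqN abszN.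
Qed.

Lemma padic_logn_absD (m n : int) k : m + n != 0 ->
  (m != 0 -> (k <= logn q `|m|)%N) -> (n != 0 -> (k <= logn q `|n|)%N) ->
  (k <= logn q `|(m + n)%R|)%N.
Proof.
move=> mn0 hm hn.
have dv (z : int) : (z != 0 -> (k <= logn q `|z|)%N) -> ((q ^ k)%N%:Z %| z)%Z.
  have [-> _|z0 /(_ isT) h] := eqVneq z 0; first exact: dvdz0.
  by rewrite dvdzE /= pfactor_dvdn // absz_gt0.
have := rpredD (dv _ hm) (dv _ hn).
by rewrite dvdzE /= pfactor_dvdn // absz_gt0.
Qed.

Lemma padic_norm_leD x y : norm (x + y) <= Num.max (norm x) (norm y).
Proof.
wlog lexy : x y / norm x <= norm y => [H|].
  by case/orP: (le_total (norm x) (norm y)) => /H //; rewrite addrC maxC.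
rewrite (max_idPr lexy).
have [->|x0] := eqVneq x 0; first by rewrite add0r.
have [y0|y0] := eqVneq y 0.
  by move: lexy; rewrite y0 padic_norm0 addr0.
have [->|s0] := eqVneq (x + y) 0; first by rewrite padic_norm0 padic_norm_ge0.
pose a := numq x * denq y; pose b := numq y * denq x; pose D := denq x * denq y.
have D0 : D != 0 by rewrite mulf_neq0 ?denq_eq0.
have a0 : a != 0 by rewrite mulf_neq0 ?numq_eq0 ?denq_eq0.
have b0 : b != 0 by rewrite mulf_neq0 ?numq_eq0 ?denq_eq0.
have dx0 : (denq x)%:Q != 0 by rewrite intr_eq0 denq_eq0.
have dy0 : (denq y)%:Q != 0 by rewrite intr_eq0 denq_eq0.
have xE : x = a%:Q / D%:Q.
  by rewrite !intrM invfM mulrACA divff // mulr1 divq_num_den.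
have yE : y = b%:Q / D%:Q.
  by rewrite !intrM [(denq x)%:Q * (denq y)%:Q]mulrC invfM mulrACA divff // mulr1 divq_num_den.
have sE : x + y = (a + b)%:Q / D%:Q by rewrite {1}xE {1}yE -mulrDl -intrD.
have ab0 : a + b != 0.
  by apply: contraNneq s0 => ab0; rewrite sE ab0 mul0r.
move: lexy; rewrite sE {1}xE yE !padic_norm_frac // !ler_eXz2l ?padic_p_gt1 //.
rewrite !lerD2l !lerN2 !lez_nat => leba.
by apply: padic_logn_absD.
Qed.

Lemma padic_norm_isosceles x y : norm y < norm x -> norm (x + y) = norm x.
Proof.
move=> lt; apply/le_anti/andP; split.
  by apply: le_trans (padic_norm_leD _ _) _; rewrite ge_max lexx ltW.
have := padic_norm_leD (x + y) (- y); rewrite addrK padic_normN le_max.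
by case/orP => // /le_lt_trans/(_ lt); rewrite ltxx.
Qed.

End padic_norm_theory.

Definition padic_cauchy (p : nat) : {pred nat -> rat} := fun u =>
  `[< forall e, 0 < e ->
      exists N, forall m n, (N <= m)%N -> (N <= n)%N -> padic_norm p (u m - u n) < e >].

Section padic_cauchy_ring.
Variable p : primeT.
Local Notation norm := (padic_norm (val p)).

Lemma padic_cauchy_bounded u : u \in padic_cauchy (val p) ->
  exists2 M, 0 < M & forall n, norm (u n) <= M.
Proof.
move=> /asboolP /(_ 1 ltr01)[N hN].
exists (1 + norm (u N) + \sum_(i < N) norm (u i)).
  by rewrite -addrA ltr_pwDl // addr_ge0 ?padic_norm_ge0 // sumr_ge0 // => i _; exact: padic_norm_ge0.
move=> n; have [Nn|nN] := leqP N n.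
  rewrite -[u n](subrK (u N)); apply: le_trans (padic_norm_leD _ _ _) _.
  apply: (@le_trans _ _ (1 + norm (u N))).
    rewrite ge_max; apply/andP; split; last by rewrite lerDr.
    by rewrite ler_wpDr ?padic_norm_ge0 // ltW // hN.
  by rewrite lerDl sumr_ge0 // => i _; exact: padic_norm_ge0.
rewrite ler_wpDl //; first by rewrite addr_ge0 // padic_norm_ge0.
rewrite (bigD1 (Ordinal nN)) //= lerDl sumr_ge0 // => i _; exact: padic_norm_ge0.
Qed.

Lemma padic_cauchy_subring : subring_closed (padic_cauchy (val p)).
Proof.
split.
- by apply/asboolP => e e0; exists 0%N => m n _ _; rewrite subrr padic_norm0.
- move=> u v /asboolP cu /asboolP cv; apply/asboolP => e e0.
  have [M hM] := cu _ e0; have [N hN] := cv _ e0.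
  exists (maxn M N) => m n; rewrite !geq_max => /andP[Mm Nm] /andP[Mn Nn].
  have -> : (u - v) m - (u - v) n = (u m - u n) + - (v m - v n).
    by rewrite /= !opprD !opprK addrACA.
  apply: le_lt_trans (padic_norm_leD _ _ _) _.
  by rewrite padic_normN gt_max hM // hN.
- move=> u v cu cv; apply/asboolP => e e0.
  have [B B0 hB] := padic_cauchy_bounded cu.
  have [C C0 hC] := padic_cauchy_bounded cv.
  move/asboolP: cu => cu; move/asboolP: cv => cv.
  have [M hM] := cu _ (divr_gt0 e0 C0); have [N hN] := cv _ (divr_gt0 e0 B0).
  exists (maxn M N) => m n; rewrite !geq_max => /andP[Mm Nm] /andP[Mn Nn].
  have -> : (u * v) m - (u * v) n = u m * (v m - v n) + (u m - u n) * v n.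
    by rewrite mulrBr mulrBl addrA subrK.
  apply: le_lt_trans (padic_norm_leD _ _ _) _; rewrite !padic_normM gt_max.
  apply/andP; split.
    apply: (@le_lt_trans _ _ (B * norm (v m - v n))).
      by rewrite ler_wpM2r ?padic_norm_ge0.
    by rewrite mulrC -ltr_pdivlMr // hN.
  apply: (@le_lt_trans _ _ (norm (u m - u n) * C)).
    by rewrite ler_wpM2l ?padic_norm_ge0.
  by rewrite -ltr_pdivlMr // hM.
Qed.

HB.instance Definition _ :=
  GRing.isSubringClosed.Build (nat -> rat) (padic_cauchy (val p)) padic_cauchy_subring.

Record padic_seq := PadicSeq {
  padic_seq_val :> nat -> rat;
  padic_seqP : padic_seq_val \in padic_cauchy (val p) }.

HB.instance Definition _ := [isSub for padic_seq_val].
HB.instance Definition _ := [Choice of padic_seq by <:].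
HB.instance Definition _ := [SubChoice_isSubComNzRing of padic_seq by <:].

Definition padic_null : {pred padic_seq} := fun u =>
  `[< forall e, 0 < e -> exists N, forall n, (N <= n)%N -> norm (u n) < e >].

Lemma padic_null_ideal : idealr_closed padic_null.
Proof.
split.
- by apply/asboolP => e e0; exists 0%N => n _; rewrite padic_norm0.
- apply/negP => /asboolP /(_ 1 ltr01)[N /(_ N (leqnn N))].
  by rewrite padic_norm1 ltxx.
- move=> a u v /asboolP nu /asboolP nv; apply/asboolP => e e0.
  have [B B0 hB] := padic_cauchy_bounded (padic_seqP a).
  have [M hM] := nu _ (divr_gt0 e0 B0); have [N hN] := nv _ e0.
  exists (maxn M N) => n; rewrite geq_max => /andP[Mn Nn].
  apply: le_lt_trans (padic_norm_leD _ _ _) _; rewrite padic_normM gt_max hN // andbT.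
  apply: (@le_lt_trans _ _ (B * norm (u n))).
    by rewrite ler_wpM2r ?padic_norm_ge0.
  by rewrite mulrC -ltr_pdivlMr // hM.
Qed.

HB.instance Definition _ := isIdealr.Build padic_seq padic_null padic_null_ideal.

(* Q_p: p-adic Cauchy sequences of rationals modulo null sequences *)
Definition padic := {ideal_quot padic_null}.
HB.instance Definition _ := GRing.ComNzRing.on padic.
HB.instance Definition _ := Quotient.on padic.

End padic_cauchy_ring.

(* |x|_p: the norms of the terms of a Cauchy sequence representing x != 0 are
   eventually constant; for x = 0 either they are eventually 0 or they have no
   eventual value, and the default 0 of xget is returned. *)
Definition padic_abs (p : primeT) (x : padic p) : rat :=
  xget 0 [set a | exists N, forall n, (N <= n)%N ->
                  padic_norm (val p) (repr x n) = a].

Section padic_abs_theory.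
Variable p : primeT.
Local Notation norm := (padic_norm (val p)).
Local Notation Qp := (padic p).
Local Notation pi := (\pi_Qp)%qT.
Implicit Types (u v w : padic_seq p) (x y : Qp).

Lemma padic_not_nullP w : w \notin @padic_null p ->
  exists2 a, 0 < a & exists N, forall n, (N <= n)%N -> norm (w n) = a.
Proof.
move=> /asboolPn /existsNP[e /not_implyP[e0 /forallNP hw]].
have /asboolP/(_ e e0)[N hN] := padic_seqP w.
have /existsNP[k /not_implyP[Nk /negP]] := hw N; rewrite -leNgt => ek.
exists (norm (w k)); first exact: lt_le_trans ek.
exists N => n Nn; rewrite -[w n](subrK (w k)) addrC padic_norm_isosceles //.
by apply: lt_le_trans ek; exact: hN.
Qed.

Lemma padic_repr_null u : repr (pi u) - u \in @padic_null p.
Proof. by rewrite Quotient.idealrBE reprK. Qed.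

Lemma padic_absP u :
  (u \in @padic_null p /\ padic_abs (pi u) = 0) \/
  [/\ u \notin @padic_null p, 0 < padic_abs (pi u)
    & exists N, forall n, (N <= n)%N -> norm (u n) = padic_abs (pi u)].
Proof.
have hn := padic_repr_null u; set v := repr _ in hn.
have [nu|nu] := boolP (u \in @padic_null p); [left|right].
  split=> //; rewrite /padic_abs -/v.
  have nv : v \in @padic_null p by rewrite -[v](subrK u) rpredD.
  case: xgetP => // a _ [N hN]; apply/eqP/negPn/negP => a0.
  have a_gt0 : 0 < a.
    by rewrite lt_def a0 -(hN N) // padic_norm_ge0.
  have /asboolP/(_ a a_gt0)[M hM] := nv.
  by have := hM (maxn M N) (leq_maxl _ _); rewrite hN ?leq_maxr // ltxx.
have [a a0 [N hN]] := padic_not_nullP nu.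
have /asboolP/(_ a a0)[M hM] := hn.
have hv n : (maxn M N <= n)%N -> norm (v n) = a.
  rewrite geq_max => /andP[Mn Nn].
  have -> : v n = u n + (v - u) n by rewrite /= addrC subrK.
  by rewrite padic_norm_isosceles hN // hM.
have -> : padic_abs (pi u) = a.
  rewrite /padic_abs -/v; case: xgetP => [b _ [K hK]|/(_ a) []].
    by rewrite -(hK (maxn K (maxn M N))) ?leq_maxl // hv // leq_maxr.
  by exists (maxn M N).
by split => //; exists N.
Qed.

Lemma padic_absE u (e : rat) : 0 < e ->
  padic_abs (pi u) <= e <-> exists N, forall n, (N <= n)%N -> norm (u n) <= e.
Proof.
move=> e0; case: (padic_absP u) => [[nu ->]|[nu a0 [N hN]]].
  split=> _; last exact: ltW.
  by have /asboolP/(_ e e0)[N hN] := nu; exists N => n /hN/ltW.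
split=> [le|[M hM]]; first by exists N => n /hN ->.
by rewrite -(hN (maxn M N)) ?leq_maxr // hM // leq_maxl.
Qed.

Lemma padic_abs_ge0 x : 0 <= padic_abs x.
Proof. by rewrite -[x]reprK; case: (padic_absP (repr x)) => [[_ ->]|[_ /ltW]]. Qed.

Lemma padic_abs_eq0 x : (padic_abs x == 0) = (x == 0).
Proof.
rewrite -[x]reprK; set u := repr x.
have -> : (pi u == 0) = (u \in @padic_null p).
  by rewrite -[u]subr0 Quotient.idealrBE subr0 !piE.
case: (padic_absP u) => [[-> ->]|[/negPf -> a0 _]]; first by rewrite eqxx.
by rewrite gt_eqF.
Qed.

Lemma padic_abs0 : padic_abs (0 : Qp) = 0.
Proof. by apply/eqP; rewrite padic_abs_eq0. Qed.

Lemma padic_absM x y : padic_abs (x * y) = padic_abs x * padic_abs y.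
Proof.
have [->|x0] := eqVneq x 0; first by rewrite mul0r padic_abs0 mul0r.
have [->|y0] := eqVneq y 0; first by rewrite mulr0 padic_abs0 mulr0.
move: x0 y0; rewrite -padic_abs_eq0 -[y == 0]padic_abs_eq0.
rewrite -[x]reprK -[y]reprK; set u := repr x; set v := repr y => u0 v0.
case: (padic_absP u) => [[_ e]|[_ _ [N hN]]]; first by rewrite e eqxx in u0.
case: (padic_absP v) => [[_ e]|[_ _ [M hM]]]; first by rewrite e eqxx in v0.
have -> : pi u * pi v = pi (u * v) by rewrite !piE.
have uv n : (maxn N M <= n)%N -> norm ((u * v) n) = padic_abs (pi u) * padic_abs (pi v).
  by rewrite geq_max => /andP[Nn Mn]; rewrite padic_normM hN // hM.
case: (padic_absP (u * v)) => [[nuv _]|[_ _ [K hK]]].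
  have ab0 : 0 < padic_abs (pi u) * padic_abs (pi v).
    by rewrite mulr_gt0 // lt_def ?u0 ?v0 padic_abs_ge0.
  have /asboolP/(_ _ ab0)[K hK] := nuv.
  by have := hK (maxn K (maxn N M)) (leq_maxl _ _); rewrite uv ?leq_maxr // ltxx.
by rewrite -(hK (maxn K (maxn N M))) ?leq_maxl // uv // leq_maxr.
Qed.

Lemma padic_absN x : padic_abs (- x) = padic_abs x.
Proof.
apply/eqP; rewrite -(@eqrXn2 _ 2) // ?padic_abs_ge0 //.
by rewrite !expr2 -!padic_absM mulrNN.
Qed.

Lemma padic_abs_leD x y : padic_abs (x + y) <= Num.max (padic_abs x) (padic_abs y).
Proof.
set m := Num.max _ _.
have [m0|m0] := eqVneq m 0.
  have : padic_abs x <= 0 /\ padic_abs y <= 0.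
    by split; rewrite -m0 le_max lexx ?orbT.
  rewrite !le_eqVlt !(le_gtF (padic_abs_ge0 _)) !orbF !padic_abs_eq0.
  by move=> [/eqP -> /eqP ->]; rewrite addr0 padic_abs0 m0.
have m_gt0 : 0 < m by rewrite lt_def m0 le_max padic_abs_ge0.
have : padic_abs x <= m /\ padic_abs y <= m by split; rewrite le_max lexx ?orbT.
rewrite -[x]reprK -[y]reprK; set u := repr x; set v := repr y.
move=> [/(padic_absE _ m_gt0)[N hN] /(padic_absE _ m_gt0)[M hM]].
have -> : pi u + pi v = pi (u + v) by rewrite !piE.
apply/(padic_absE _ m_gt0); exists (maxn N M) => n; rewrite geq_max => /andP[Nn Mn].
by apply: le_trans (padic_norm_leD _ _ _) _; rewrite ge_max hN // hM.
Qed.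

Lemma padic_abs1 : padic_abs (1 : Qp) = 1.
Proof.
have := padic_absM 1 1; rewrite mulr1 => /eqP.
rewrite -{1}[padic_abs 1]mulr1 -subr_eq0 -mulrBr mulf_eq0 padic_abs_eq0 oner_eq0.
by rewrite subr_eq0 => /eqP <-.
Qed.

Definition padic_cst_subproof (a : rat) : (fun=> a) \in padic_cauchy (val p).
Proof.
by apply/asboolP => e e0; exists 0%N => m n _ _; rewrite subrr padic_norm0.
Qed.

Definition padic_of_rat (a : rat) : Qp := pi (PadicSeq (padic_cst_subproof a)).

Lemma padic_of_rat_abs a : padic_abs (padic_of_rat a) = norm a.
Proof.
rewrite /padic_of_rat; set u := PadicSeq _.
case: (padic_absP u) => [[nu ->]|[_ _ [N /(_ N (leqnn N)) <-]]] //.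
apply/esym/eqP; apply/negPn/negP => a0.
have a_gt0 : 0 < norm a by rewrite lt_def a0 padic_norm_ge0.
by have /asboolP/(_ _ a_gt0)[N /(_ N (leqnn N))] := nu; rewrite ltxx.
Qed.

Lemma padic_of_rat_zmod_morphism : zmod_morphism padic_of_rat.
Proof.
move=> a b; rewrite /padic_of_rat -pi_is_zmod_morphism; congr (pi _).
exact: val_inj.
Qed.

Lemma padic_of_rat_monoid_morphism : monoid_morphism padic_of_rat.
Proof.
split=> [|a b].
  by rewrite /padic_of_rat -(rmorph1 pi); congr (pi _); exact: val_inj.
by rewrite /padic_of_rat -rmorphM; congr (pi _); exact: val_inj.
Qed.

HB.instance Definition _ :=
  GRing.isZmodMorphism.Build rat Qp padic_of_rat padic_of_rat_zmod_morphism.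
HB.instance Definition _ :=
  GRing.isMonoidMorphism.Build rat Qp padic_of_rat padic_of_rat_monoid_morphism.

Definition padic_open (U : set Qp) :=
  forall x, U x -> exists2 e, 0 < e & forall y, padic_abs (y - x) < e -> U y.

Lemma padic_openT : padic_open setT.
Proof. by move=> x _; exists 1. Qed.

Lemma padic_openI : setI_closed padic_open.
Proof.
move=> U V oU oV x [Ux Vx].
have [e e0 he] := oU _ Ux; have [f f0 hf] := oV _ Vx.
exists (Num.min e f); first by rewrite lt_min e0.
by move=> y; rewrite lt_min => /andP[/he ? /hf ?].
Qed.

Lemma padic_open_bigU (I : Type) (f : I -> set Qp) :
  (forall i, padic_open (f i)) -> padic_open (\bigcup_i f i).
Proof.
move=> of_ x [i _ fx]; have [e e0 he] := of_ i _ fx.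
by exists e => // y /he fy; exists i.
Qed.

HB.instance Definition _ :=
  isOpenTopological.Build Qp padic_openT padic_openI padic_open_bigU.

Definition padic_int : set Qp := [set x | padic_abs x <= 1].

End padic_abs_theory.
Arguments padic_int : clear implicits.
Arguments padic_of_rat : clear implicits.

(* A_f: the restricted product of the Q_p with respect to the Z_p *)
Record fin_adele := FinAdele {
  fin_adele_val :> forall p : primeT, padic p;
  fin_adeleP : finite_set [set p | ~ padic_int p (fin_adele_val p)] }.

HB.instance Definition _ := gen_eqMixin fin_adele.
HB.instance Definition _ := gen_choiceMixin fin_adele.

Lemma fin_adele_eq (x y : fin_adele) : (forall p, x p = y p) -> x = y.
Proof.
case: x y => x xP [y yP] /= xy; have e : x = y by exact: functional_extensionality_dep.
by case: _ / e yP => yP; congr FinAdele; exact: Prop_irrelevance.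
Qed.

Section fin_adele_ring.
Implicit Types x y z : fin_adele.

Lemma fin_adele_cst_subproof (a : rat) :
  finite_set [set p : primeT | ~ padic_int p (padic_of_rat p a)].
Proof.
apply: (@sub_finite_set _ _ (val @^-1` [set` primes `|denq a|%N])).
  move=> p /= /negP; rewrite padic_of_rat_abs.
  rewrite mem_primes absz_gt0 denq_neq0 (valP p) /=.
  apply: contraNT => ndvd; rewrite /padic_norm; case: eqP => // _.
  have /eqP -> : logn (val p) `|denq a|%N == 0%N.
    rewrite -leqn0 leqNgt; apply: contra ndvd.
    by rewrite logn_gt0 mem_primes => /and3P[].
  rewrite sub0r -invr_expz invf_le1 ?exprn_gt0 ?padic_p_gt0 //.
  by rewrite exprn_ege1 // ltW // padic_p_gt1.
apply: finite_preimage; last exact: finite_seq.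
by move=> p q _ _; exact: val_inj.
Qed.

Definition fin_adele_of_rat (a : rat) : fin_adele := FinAdele (fin_adele_cst_subproof a).

Lemma fin_adele_opp_subproof x : finite_set [set p | ~ padic_int p (- x p)].
Proof.
by apply: sub_finite_set (fin_adeleP x) => p /=; rewrite /padic_int /= padic_absN.
Qed.

Lemma fin_adele_add_subproof x y : finite_set [set p | ~ padic_int p (x p + y p)].
Proof.
have : finite_set ([set p | ~ padic_int p (x p)] `|` [set p | ~ padic_int p (y p)]).
  by rewrite finite_setU; split; exact: fin_adeleP.
apply: sub_finite_set => p /= xyp; apply/not_andP => -[xp yp]; apply: xyp.
by apply: le_trans (padic_abs_leD _ _) _; rewrite ge_max xp.
Qed.

Lemma fin_adele_mul_subproof x y : finite_set [set p | ~ padic_int p (x p * y p)].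
Proof.
have : finite_set ([set p | ~ padic_int p (x p)] `|` [set p | ~ padic_int p (y p)]).
  by rewrite finite_setU; split; exact: fin_adeleP.
apply: sub_finite_set => p /= xyp; apply/not_andP => -[xp yp]; apply: xyp.
by rewrite /padic_int /= padic_absM mulr_ile1 // padic_abs_ge0.
Qed.

Definition fin_adele_opp x := FinAdele (fin_adele_opp_subproof x).
Definition fin_adele_add x y := FinAdele (fin_adele_add_subproof x y).
Definition fin_adele_mul x y := FinAdele (fin_adele_mul_subproof x y).

Lemma fin_adele_addA : associative fin_adele_add.
Proof. by move=> x y z; apply: fin_adele_eq => p /=; rewrite addrA. Qed.

Lemma fin_adele_addC : commutative fin_adele_add.
Proof. by move=> x y; apply: fin_adele_eq => p /=; rewrite addrC. Qed.

Lemma fin_adele_add0 : left_id (fin_adele_of_rat 0) fin_adele_add.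
Proof. by move=> x; apply: fin_adele_eq => p /=; rewrite rmorph0 add0r. Qed.

Lemma fin_adele_addN : left_inverse (fin_adele_of_rat 0) fin_adele_opp fin_adele_add.
Proof. by move=> x; apply: fin_adele_eq => p /=; rewrite rmorph0 addNr. Qed.

HB.instance Definition _ := GRing.isZmodule.Build fin_adele
  fin_adele_addA fin_adele_addC fin_adele_add0 fin_adele_addN.

Lemma fin_adele_mulA : associative fin_adele_mul.
Proof. by move=> x y z; apply: fin_adele_eq => p /=; rewrite mulrA. Qed.

Lemma fin_adele_mulC : commutative fin_adele_mul.
Proof. by move=> x y; apply: fin_adele_eq => p /=; rewrite mulrC. Qed.

Lemma fin_adele_mul1 : left_id (fin_adele_of_rat 1) fin_adele_mul.
Proof. by move=> x; apply: fin_adele_eq => p /=; rewrite rmorph1 mul1r. Qed.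

Lemma fin_adele_mulDl : left_distributive fin_adele_mul +%R.
Proof. by move=> x y z; apply: fin_adele_eq => p /=; rewrite mulrDl. Qed.

Lemma fin_adele_1neq0 : fin_adele_of_rat 1 != 0.
Proof.
apply/eqP => /(congr1 (fun x : fin_adele => x (exist _ 2%N isT))) /eqP.
by rewrite /= rmorph1 rmorph0 oner_eq0.
Qed.

HB.instance Definition _ := GRing.Zmodule_isComNzRing.Build fin_adele
  fin_adele_mulA fin_adele_mulC fin_adele_mul1 fin_adele_mulDl fin_adele_1neq0.

Lemma fin_adele_of_rat_zmod_morphism : zmod_morphism fin_adele_of_rat.
Proof. by move=> a b; apply: fin_adele_eq => p /=; rewrite rmorphB. Qed.

Lemma fin_adele_of_rat_monoid_morphism : monoid_morphism fin_adele_of_rat.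
Proof. by split=> // a b; apply: fin_adele_eq => p /=; rewrite rmorphM. Qed.

HB.instance Definition _ := GRing.isZmodMorphism.Build rat fin_adele
  fin_adele_of_rat fin_adele_of_rat_zmod_morphism.
HB.instance Definition _ := GRing.isMonoidMorphism.Build rat fin_adele
  fin_adele_of_rat fin_adele_of_rat_monoid_morphism.

End fin_adele_ring.

Section fin_adele_topology.

(* Restricted product topology, with base the products of open sets V_p, all but
   finitely many of which are Z_p. *)
Definition fin_adele_open (U : set fin_adele) := forall x, U x ->
  exists V : forall p, set (padic p),
    [/\ forall p, open (V p) /\ V p (x p),
        finite_set [set p | V p <> padic_int p]
      & forall y : fin_adele, (forall p, V p (y p)) -> U y].

Lemma padic_int_open p : open (padic_int p).
Proof.
move=> x x1; exists 1 => // y yx; rewrite /padic_int /= -[y](subrK x).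
by apply: le_trans (padic_abs_leD _ _) _; rewrite ge_max ltW.
Qed.

Lemma fin_adele_openT : fin_adele_open setT.
Proof.
move=> x _; exists (fun p => [set y | padic_int p (x p) -> padic_int p y]).
split=> // [p|].
  split=> //; have [xp|nxp] := pselect (padic_int p (x p)).
    by rewrite (_ : mkset _ = padic_int p);
      [exact: padic_int_open | apply/seteqP; split=> y //=; apply].
  by rewrite (_ : mkset _ = setT); [exact: openT | apply/seteqP; split=> // y _ /= /nxp].
apply: sub_finite_set (fin_adeleP x) => p /=; apply: contra_not => xp.
by apply/seteqP; split=> y //=; apply.
Qed.

Lemma fin_adele_openI : setI_closed fin_adele_open.
Proof.
move=> U U' oU oU' x [/oU[V [Vx fV VU]] /oU'[V' [Vx' fV' VU']]].
exists (fun p => V p `&` V' p); split.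
- move=> p; have [oV Vp] := Vx p; have [oV' V'p] := Vx' p.
  by split; [exact: openI | split].
- have : finite_set ([set p | V p <> padic_int p] `|` [set p | V' p <> padic_int p]).
    by rewrite finite_setU.
  apply: sub_finite_set => p /= h; apply/not_andP => -[e e']; apply: h.
  by rewrite e e' setIid.
- move=> y Vy; split; first by apply: VU => p; have [] := Vy p.
  by apply: VU' => p; have [] := Vy p.
Qed.

Lemma fin_adele_open_bigU (I : Type) (f : I -> set fin_adele) :
  (forall i, fin_adele_open (f i)) -> fin_adele_open (\bigcup_i f i).
Proof.
move=> of_ x [i _ /of_[V [Vx fV VU]]].
by exists V; split=> // y /VU fy; exists i.
Qed.

HB.instance Definition _ := isOpenTopological.Build fin_adele
  fin_adele_openT fin_adele_openI fin_adele_open_bigU.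
HB.instance Definition _ := isPointed.Build fin_adele 0.

End fin_adele_topology.

Definition adele (R : realType) : Type := (R * fin_adele)%type.
HB.instance Definition _ (R : realType) := GRing.ComNzRing.copy (adele R) (R * fin_adele)%type.
HB.instance Definition _ (R : realType) := Topological.copy (adele R) (R * fin_adele)%type.
HB.instance Definition _ (R : realType) := isPointed.Build (adele R) 0.

Section adele_maps.
Variable R : realType.

Definition adele_of_rat (a : rat) : adele R := (ratr a, fin_adele_of_rat a).

Lemma adele_of_rat_zmod_morphism : zmod_morphism adele_of_rat.
Proof. by move=> a b; rewrite /adele_of_rat !rmorphB. Qed.

Lemma adele_of_rat_monoid_morphism : monoid_morphism adele_of_rat.
Proof. by split=> [|a b]; rewrite /adele_of_rat ?rmorph1 ?rmorphM. Qed.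

HB.instance Definition _ := GRing.isZmodMorphism.Build rat (adele R)
  adele_of_rat adele_of_rat_zmod_morphism.
HB.instance Definition _ := GRing.isMonoidMorphism.Build rat (adele R)
  adele_of_rat adele_of_rat_monoid_morphism.

Definition delta (d : nat) (q : 'rV[rat]_d) : 'rV[adele R]_d := map_mx adele_of_rat q.
Definition pi_inf (d : nat) (x : 'rV[adele R]_d) : 'rV[R]_d :=
  map_mx (fun a : adele R => a.1) x.
Definition pi_int (d : nat) (x : 'rV[adele R]_d) : 'rV[fin_adele]_d :=
  map_mx (fun a : adele R => a.2) x.

End adele_maps.

Definition SL (d : nat) (K : comNzRingType) : Type :=
  set_type [set M : 'M[K]_d | \det M = 1].

Section SL_group.
Variables (d : nat) (K : comNzRingType).
Local Notation SL := (SL d K).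

HB.instance Definition _ := SubChoice.on SL.

Lemma SL_det (M : SL) : \det (val M) = 1.
Proof. exact: (set_valP M). Qed.

Definition SL_of (M : 'M[K]_d) (hM : \det M = 1) : SL := SigSub (mem_set hM).

Lemma SL_one_subproof : \det (1%:M : 'M[K]_d) = 1. Proof. exact: det1. Qed.

Lemma SL_mul_subproof (M N : SL) : \det (val M *m val N) = 1.
Proof. by rewrite det_mulmx !SL_det mulr1. Qed.

Lemma SL_inv_subproof (M : SL) : \det (\adj (val M)) = 1.
Proof. by have := congr1 determinant (mul_mx_adj (val M)); rewrite det_mulmx SL_det mul1r => ->; rewrite det1. Qed.

Definition SL_one := SL_of SL_one_subproof.
Definition SL_mul (M N : SL) := SL_of (SL_mul_subproof M N).
Definition SL_inv (M : SL) := SL_of (SL_inv_subproof M).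

Lemma SL_mulA : associative SL_mul.
Proof. by move=> L M N; apply: val_inj; rewrite /= mulmxA. Qed.

Lemma SL_mul1 : left_id SL_one SL_mul.
Proof. by move=> M; apply: val_inj; rewrite /= mul1mx. Qed.

Lemma SL_mulr1 : right_id SL_one SL_mul.
Proof. by move=> M; apply: val_inj; rewrite /= mulmx1. Qed.

Lemma SL_mulV : left_inverse SL_one SL_inv SL_mul.
Proof. by move=> M; apply: val_inj; rewrite /= mul_adj_mx SL_det. Qed.

Lemma SL_mulrV : right_inverse SL_one SL_inv SL_mul.
Proof. by move=> M; apply: val_inj; rewrite /= mul_mx_adj SL_det. Qed.

HB.instance Definition _ :=
  isGroup.Build SL SL_mulA SL_mul1 SL_mulr1 SL_mulV SL_mulrV.

End SL_group.

Definition ASL (d : nat) (K : comNzRingType) : Type := (SL d K * 'rV[K]_d)%type.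

Section ASL_group.
Variables (d : nat) (K : comNzRingType).
Local Notation ASL := (ASL d K).

HB.instance Definition _ := Choice.on ASL.

Definition ASL_act (x : 'rV[K]_d) (g : ASL) : 'rV[K]_d := x *m val g.1 + g.2.

Definition ASL_one : ASL := (1%g, 0).
Definition ASL_mul (g h : ASL) : ASL := ((g.1 * h.1)%g, ASL_act g.2 h).
Definition ASL_inv (g : ASL) : ASL := ((g.1^-1)%g, - (g.2 *m val (g.1^-1)%g)).

Lemma ASL_mulA : associative ASL_mul.
Proof.
by move=> f g h; congr pair; rewrite /= ?mulgA // /ASL_act /= mulmxDl addrA mulmxA.
Qed.

Lemma ASL_mul1 : left_id ASL_one ASL_mul.
Proof. by move=> [M z]; rewrite /ASL_mul /ASL_act /= mul1g mul0mx add0r. Qed.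

Lemma ASL_mulr1 : right_id ASL_one ASL_mul.
Proof. by move=> [M z]; rewrite /ASL_mul /ASL_act /= mulg1 mulmx1 addr0. Qed.

Lemma ASL_mulV : left_inverse ASL_one ASL_inv ASL_mul.
Proof.
move=> [M z]; rewrite /ASL_mul /ASL_act /= mulVg mulNmx -mulmxA.
have -> : val (M^-1)%g *m val M = 1%:M := congr1 val (mulVg M).
by rewrite mulmx1 addNr.
Qed.

Lemma ASL_mulrV : right_inverse ASL_one ASL_inv ASL_mul.
Proof. by move=> [M z]; rewrite /ASL_mul /ASL_act /= mulgV subrr. Qed.

HB.instance Definition _ :=
  isGroup.Build ASL ASL_mulA ASL_mul1 ASL_mulr1 ASL_mulV ASL_mulrV.

Lemma ASL_actM (x : 'rV[K]_d) (g h : ASL) : ASL_act x (g * h)%g = ASL_act (ASL_act x g) h.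
Proof. by rewrite /ASL_act /= mulmxDl mulmxA addrA. Qed.

End ASL_group.

Section adelic_groups.
Variables (R : realType) (d : nat).
Local Notation A := (adele R).

HB.instance Definition _ := Topological.copy (SL d A)
  (set_type [set M : 'M[A]_d | \det M = 1]).
HB.instance Definition _ := isPointed.Build (SL d A) 1%g.
HB.instance Definition _ := Topological.copy (ASL d A) (SL d A * 'rV[A]_d)%type.
HB.instance Definition _ := isPointed.Build (ASL d A) 1%g.

Lemma SL_delta_subproof (g : SL d rat) : \det (map_mx (@adele_of_rat R) (val g)) = 1.
Proof. by rewrite det_map_mx SL_det rmorph1. Qed.

Definition SL_delta (g : SL d rat) : SL d A := SL_of (SL_delta_subproof g).
Definition ASL_delta (g : ASL d rat) : ASL d A := (SL_delta g.1, delta R g.2).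

Lemma SL_delta_morph : {morph SL_delta : x y / (x * y)%g}.
Proof. by move=> x y; apply: val_inj; rewrite /= map_mxM. Qed.

Lemma ASL_delta_morph : {morph ASL_delta : x y / (x * y)%g}.
Proof.
move=> x y; congr pair; first exact: SL_delta_morph.
by rewrite /delta /ASL_act /= map_mxD map_mxM.
Qed.

Lemma SL_delta1 : SL_delta 1%g = 1%g.
Proof. by apply: val_inj; rewrite /= map_mx1. Qed.

Lemma ASL_delta1 : ASL_delta 1%g = 1%g.
Proof. by congr pair; [exact: SL_delta1 | rewrite /delta /= map_mx0]. Qed.

HB.instance Definition _ := isMultiplicative.Build (SL d rat) (SL d A) SL_delta SL_delta_morph.
HB.instance Definition _ := isMultiplicative.Build (ASL d rat) (ASL d A) ASL_delta ASL_delta_morph.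
HB.instance Definition _ := Multiplicative_isUMagmaMorphism.Build (SL d rat) (SL d A) SL_delta SL_delta1.
HB.instance Definition _ := Multiplicative_isUMagmaMorphism.Build (ASL d rat) (ASL d A) ASL_delta ASL_delta1.

End adelic_groups.

(* As for PreTopologicalNmodule, continuity of the operations is not recorded. *)
#[short(type="preTopologicalGroupType")]
HB.structure Definition PreTopologicalGroup := {G of Group G & PointedTopological G}.

HB.instance Definition _ (R : realType) d := Group.on (SL d (adele R)).
HB.instance Definition _ (R : realType) d := Group.on (ASL d (adele R)).

Section coset_space.
Local Open Scope quotient_scope.
Variables (H : groupType) (G : preTopologicalGroupType) (f : UMagmaMorphism.type H G).

(* Gamma x = Gamma y, where Gamma is the image of f *)
Definition coset_rel : rel G := fun x y => `[< exists h, y = (f h * x)%g >].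

Lemma coset_rel_equiv : equiv_class_of coset_rel.
Proof.
split=> [x|x y|y x z].
- by apply/asboolP; exists 1%g; rewrite gmulf1 mul1g.
- by apply: asbool_equiv_eq; split=> -[h ->]; exists h^-1%g;
    rewrite gmulfV mulKg.
- move=> /asboolP[h ->] /asboolP[k ->]; apply/asboolP; exists (k * h)%g.
  by rewrite gmulfM mulgA.
Qed.

Canonical coset_rel_equivRel := EquivRelPack coset_rel_equiv.
Canonical coset_rel_encModRel := defaultEncModRel coset_rel.

(* Gamma \ G with the quotient topology *)
Definition coset_space : ptopologicalType := quotient_topology {eq_quot coset_rel}.

Definition coset_proj (x : G) : coset_space := (\pi_({eq_quot coset_rel}) x)%qT.

End coset_space.

Definition borel (T : ptopologicalType) := g_sigma_algebraType (@open T).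
HB.instance Definition _ (T : ptopologicalType) := Measurable.on (borel T).

Section invariant_measures.
Local Open Scope ereal_scope.
Variable R : realType.

Definition right_invariant (H : groupType) (G : preTopologicalGroupType)
    (f : UMagmaMorphism.type H G) (mu : set (borel (coset_space f)) -> \bar R) :=
  forall (g : G) (B : set (borel (coset_space f))), measurable B ->
    mu [set coset_proj f (x * g)%g | x in coset_proj f @^-1` B] = mu B.

Definition Zhat (d : nat) : set 'rV[fin_adele]_d :=
  [set x : 'rV[fin_adele]_d | forall i (p : primeT), padic_int p (x 0%R i p)].

(* Regularity is automatic: A_f^d is locally compact and second countable. *)
Definition normalized_haar (d : nat) (m : set (borel 'rV[fin_adele]_d) -> \bar R) :=
  [/\ forall (v : 'rV[fin_adele]_d) (B : set (borel 'rV[fin_adele]_d)),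
        measurable B -> m [set (v + x)%R | x in B] = m B,
      forall C : set 'rV[fin_adele]_d, compact C -> m C < +oo
    & m (@Zhat d) = 1].

End invariant_measures.

Definition SL_space (R : realType) (d : nat) := coset_space (@SL_delta R d).
Definition ASL_space (R : realType) (d : nat) := coset_space (@ASL_delta R d).

Definition boundary (T : topologicalType) (W : set T) : set T := closure W `\` interior W.

Section euclidean.
Variable R : realType.

Definition norm2 (n : nat) (x : 'rV[R]_n) : R := Num.sqrt (\sum_i x 0 i ^+ 2).

Definition unit_ball (n : nat) : set 'rV[R]_n := [set x | norm2 x < 1].

Definition box (n : nat) (ab : 'rV[R]_n * 'rV[R]_n) : set 'rV[R]_n :=
  [set x : 'rV[R]_n | forall i, ab.1 0 i < x 0 i <= ab.2 0 i].

Definition box_vol (n : nat) (ab : 'rV[R]_n * 'rV[R]_n) : R :=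
  \prod_i Num.max 0 (ab.2 0 i - ab.1 0 i).

(* Lebesgue (outer) measure on R^n: infimum of total volumes of countable covers by boxes *)
Definition vol (n : nat) (S : set 'rV[R]_n) : \bar R :=
  ereal_inf [set (\sum_(0 <= k <oo) (box_vol (F k))%:E)%E |
    F in [set F : nat -> 'rV[R]_n * 'rV[R]_n | S `<=` \bigcup_k box (F k)]].

(* K_{c,sigma} in dimension d = n + 2, with w = m_f(W); col' 0 x is (x_2, ..., x_d) *)
Definition cone (n : nat) (w c sigma : R) : set 'rV[R]_n.+2 :=
  [set x : 'rV[R]_n.+2 | c < x 0 0 < 1 /\
    norm2 (col' 0 x) <=
      (sigma * n.+2%:R / ((1 - c ^+ n.+2) * w * fine (vol (@unit_ball n.+1))))
        `^ (n.+1%:R)^-1 * x 0 0].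

End euclidean.

Section adelic_point_sets.
Local Open Scope card_scope.
Variables (R : realType) (d : nat).

(* P(L, W) *)
Definition cut_project (L : set 'rV[adele R]_d) (W : set 'rV[fin_adele]_d) :
    set 'rV[R]_d :=
  [set pi_inf x | x in [set x | L x /\ W (pi_int x)]].

Definition SL_lattice (M : SL d (adele R)) : set 'rV[adele R]_d :=
  [set delta R q *m val M | q in setT].

Definition ASL_lattice (M : ASL d (adele R)) : set 'rV[adele R]_d :=
  [set ASL_act (delta R q) M | q in setT].

Definition SL_count (W : set 'rV[fin_adele]_d) (K : set 'rV[R]_d) (r : nat) :
    set (borel (SL_space R d)) :=
  [set coset_proj (@SL_delta R d) M |
    M in [set M | (cut_project (SL_lattice M) W `&` K) #= `I_r]].

Definition ASL_count (W : set 'rV[fin_adele]_d) (K : set 'rV[R]_d) (r : nat) :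
    set (borel (ASL_space R d)) :=
  [set coset_proj (@ASL_delta R d) M |
    M in [set M | (cut_project (ASL_lattice M) W `&` K) #= `I_r]].

Definition shifted_window (A : SL d fin_adele) (W : set 'rV[fin_adele]_d)
    (beta : 'rV[adele R]_d) : set 'rV[fin_adele]_d :=
  [set w - pi_int beta *m val A | w in W].

End adelic_point_sets.

(* alpha is in Q^d iff alpha = pi(beta) for some beta in delta(Q)^d; beta is then
   unique since delta(Q)^d projects injectively to R^d. *)
Definition Gfun (R : realType) (n : nat)
    (mf : set (borel 'rV[fin_adele]_n.+2) -> \bar R)
    (muSL : set (borel (SL_space R n.+2)) -> \bar R)
    (muASL : set (borel (ASL_space R n.+2)) -> \bar R)
    (A : SL n.+2 fin_adele) (W : set 'rV[fin_adele]_n.+2)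
    (alpha : 'rV[R]_n.+2) (c sigma : R) (r : nat) : R :=
  let K := cone (fine (mf W)) c sigma in
  fine match pselect (exists2 beta, range (@delta R n.+2) beta & alpha = pi_inf beta) with
  | left alphaQ => muSL (SL_count (shifted_window A W (sval (cid2 alphaQ))) K r)
  | right _ => muASL (ASL_count W K r)
  end.

(* Main.v *)
From HB Require Import structures.
Require Import Defs.
From mathcomp Require Import all_boot all_order all_algebra.
From mathcomp Require Import all_classical all_reals all_analysis.
From mathcomp Require Import measurable_realfun ring lra.

Set Implicit Arguments.
Unset Strict Implicit.
Unset Printing Implicit Defensive.

Import Order.TTheory GRing.Theory Num.Theory.
Import numFieldNormedType.Exports.

Local Open Scope classical_set_scope.
Local Open Scope ring_scope.

(* Let S be the lateral surface of the cone of slope rho. The elements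
   diag(s^-(d-1), s, ..., s) of SL_d(R) map S x W to S' x W, where S' lies on the
   cone surface of slope rho s^d. Infinitely many such images are pairwise disjoint
   inside one bounded set, which contains finitely many points of any given adelic
   lattice; as all images are hit with the same probability, that probability is 0.
   The counts for slopes rho and rho' differ only if a point lies in the closed shell
   between the two surfaces, and the probability of this tends to that of hitting S
   as rho' tends to rho, again because point counts in bounded sets are finite. *)

(** * Integrality in Q_p and in A_f *)

Section padic_integral.
Variable p : primeT.
Implicit Types x y : padic p.

(* [padic_int p] as a boolean predicate, closed under the ring operations. *)
Definition padic_integral : {pred padic p} := fun x => padic_abs x <= 1.

Lemma padic_integral_subring : subring_closed padic_integral.
Proof.
split=> [|x y xZ yZ|x y xZ yZ]; rewrite unfold_in.
- by rewrite padic_abs1.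
- by rewrite (le_trans (padic_abs_leD _ _)) // ge_max padic_absN; apply/andP.
- by rewrite padic_absM mulr_ile1 // padic_abs_ge0.
Qed.

HB.instance Definition _ :=
  GRing.isSubringClosed.Build (padic p) padic_integral padic_integral_subring.

Lemma padic_abs_nat (m : nat) : (0 < m)%N ->
  padic_abs (m%:R : padic p) = (val p)%:R ^- logn (val p) m.
Proof.
move=> m0; rewrite -(rmorph_nat (padic_of_rat p)) padic_of_rat_abs.
have -> : m%:R = m%:Z%:Q / 1%:Q :> rat by rewrite divr1.
by rewrite padic_norm_frac ?eqz_nat -?lt0n //= logn1 sub0r -exprnN.
Qed.

Lemma prime_expVn_lt (e : rat) : 0 < e -> exists k, (val p)%:R ^- k < e.
Proof.
move=> e0; exists (Num.bound e^-1).
rewrite invf_plt ?posrE ?exprn_gt0 ?padic_p_gt0 //.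
apply: lt_le_trans (archi_boundP _) _; first by rewrite invr_ge0 ltW.
by rewrite -natrX ler_nat ltnW // ltn_expl // prime_gt1 // (valP p).
Qed.

Lemma padic_abs_nat_le (k m : nat) : (0 < m)%N -> (k <= logn (val p) m)%N ->
  padic_abs (m%:R : padic p) <= (val p)%:R ^- k.
Proof.
move=> m0 km; rewrite padic_abs_nat // lef_pV2 ?posrE ?exprn_gt0 ?padic_p_gt0 //.
by rewrite ler_weXn2l // ltW // padic_p_gt1.
Qed.

Lemma padic_denominator x : exists k, forall m, (0 < m)%N ->
  (k <= logn (val p) m)%N -> m%:R * x \in padic_integral.
Proof.
have x1 : 0 < padic_abs x + 1 by rewrite ltr_wpDl // padic_abs_ge0.
have [k kx] : exists k, (val p)%:R ^- k < (padic_abs x + 1)^-1.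
  by apply: prime_expVn_lt; rewrite invr_gt0.
exists k => m m0 /(padic_abs_nat_le m0) km; rewrite unfold_in padic_absM.
rewrite -[leRHS](mulVf (lt0r_neq0 x1)).
by rewrite ler_pM ?padic_abs_ge0 ?(le_trans km (ltW kx)) // lerDl.
Qed.

End padic_integral.
Arguments padic_integral : clear implicits.

Lemma padic_norm_le1 (p : primeT) (a : rat) :
  (padic_norm (val p) a <= 1) = ~~ (val p %| `|denq a|)%N.
Proof.
have [->|a0] := eqVneq a 0.
  by rewrite padic_norm0 ler01 dvdn1 gtn_eqF // prime_gt1 // (valP p).
rewrite /padic_norm (negPf a0).
have [pd|pd] := boolP (val p %| _)%N => /=.
  have pn : coprime (val p) `|numq a|.
    by rewrite (coprime_dvdl pd) // coprime_sym coprime_num_den.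
  rewrite (logn_coprime pn) subr0; apply/negbTE; rewrite -ltNge.
  rewrite exprn_egt1 ?padic_p_gt1 // -lt0n logn_gt0 mem_primes.
  by rewrite (valP p) absz_gt0 denq_neq0.
rewrite logn_coprime ?prime_coprime ?(valP p) // sub0r -exprnN.
by rewrite invf_le1 ?exprn_gt0 ?padic_p_gt0 // exprn_ege1 // ltW // padic_p_gt1.
Qed.

Lemma multiple_of_prime_powers (B : set primeT) (k : primeT -> nat) : finite_set B ->
  exists2 m, (0 < m)%N & forall p, B p -> (k p <= logn (val p) m)%N.
Proof.
move=> fB; pose m := (\prod_(p <- finmap.enum_fset (fset_set B)) val p ^ k p)%N.
have m0 : (0 < m)%N by apply/prodn_gt0 => p; rewrite expn_gt0 prime_gt0 // (valP p).
exists m => // p Bp; rewrite -pfactor_dvdn ?(valP p) // /m (big_rem p) /=.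
  exact: dvdn_mulr.
by rewrite in_fset_set // inE.
Qed.

Section fin_adele_integral.
Implicit Types (x y : fin_adele) (k m : nat).

Definition fin_adele_integral : {pred fin_adele} :=
  fun x => `[< forall p, x p \in padic_integral p >].

Lemma fin_adele_integralP x :
  reflect (forall p, x p \in padic_integral p) (x \in fin_adele_integral).
Proof. exact: asboolP. Qed.

Lemma fin_adele_natE m p : (m%:R : fin_adele) p = m%:R.
Proof. by rewrite -[in LHS](rmorph_nat fin_adele_of_rat) /= rmorph_nat. Qed.

Lemma fin_adele_integral_subring : subring_closed fin_adele_integral.
Proof.
split=> [|x y /fin_adele_integralP xZ /fin_adele_integralP yZ|
         x y /fin_adele_integralP xZ /fin_adele_integralP yZ];
  apply/fin_adele_integralP => p.
- by rewrite (fin_adele_natE 1) rpred1.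
- exact: rpredB (xZ p) (yZ p).
- exact: rpredM (xZ p) (yZ p).
Qed.

HB.instance Definition _ := GRing.isSubringClosed.Build fin_adele
  fin_adele_integral fin_adele_integral_subring.

Lemma fin_adele_of_rat_integral (a : rat) :
  (fin_adele_of_rat a \in fin_adele_integral) = (a \is a Num.int).
Proof.
apply/idP/idP => [/fin_adele_integralP aZ|/intrP[z ->]]; last first.
  by rewrite rmorph_int rpred_int.
rewrite Qint_def -absz_denq eqz_nat; apply/negPn/negP => d1.
have {}d1 : (1 < `|denq a|)%N by rewrite ltn_neqAle eq_sym d1 absz_gt0 denq_neq0.
pose p : primeT := exist _ (pdiv `|denq a|) (pdiv_prime d1).
by have := aZ p; rewrite unfold_in /= padic_of_rat_abs padic_norm_le1 pdiv_dvd.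
Qed.

Definition fin_adele_frac m : {pred fin_adele} :=
  fun x => m%:R * x \in fin_adele_integral.

Lemma fin_adele_frac_zmod m : zmod_closed (fin_adele_frac m).
Proof.
by split=> [|x y xm ym]; rewrite unfold_in ?mulr0 ?rpred0 // mulrBr rpredB.
Qed.

HB.instance Definition _ m := GRing.isZmodClosed.Build fin_adele
  (fin_adele_frac m) (fin_adele_frac_zmod m).

Lemma fin_adele_integral_frac m x :
  x \in fin_adele_integral -> x \in fin_adele_frac m.
Proof. by move=> xZ; rewrite unfold_in rpredM // rpred_nat. Qed.

Lemma fin_adele_frac_dvd k m x : (k %| m)%N ->
  x \in fin_adele_frac k -> x \in fin_adele_frac m.
Proof.
by move=> /dvdnP[j ->] xk; rewrite unfold_in natrM -mulrA rpredM // rpred_nat.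
Qed.

Lemma fin_adele_fracM k m x y : x \in fin_adele_frac k -> y \in fin_adele_frac m ->
  x * y \in fin_adele_frac (k * m).
Proof. by move=> xk ym; rewrite unfold_in natrM mulrACA rpredM. Qed.

Lemma fin_adele_frac_of_rat m (a : rat) :
  (fin_adele_of_rat a \in fin_adele_frac m) = (m%:R * a \is a Num.int).
Proof. by rewrite -fin_adele_of_rat_integral rmorphM rmorph_nat. Qed.

Lemma fin_adele_fracP x : exists2 m, (0 < m)%N & x \in fin_adele_frac m.
Proof.
have /choice[k xk] p := padic_denominator (x p).
have [m m0 km] := multiple_of_prime_powers k (fin_adeleP x).
exists m => //; apply/fin_adele_integralP => p; rewrite /= fin_adele_natE.
have [xp|/km] := pselect (padic_int p (x p)); last exact: xk.
by rewrite rpredM // rpred_nat.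
Qed.

Lemma fin_adele_frac_fin (I : finType) (x : I -> fin_adele) :
  exists2 m, (0 < m)%N & forall i, x i \in fin_adele_frac m.
Proof.
have /choice[k xk] i : exists m, (0 < m)%N /\ x i \in fin_adele_frac m.
  by have [m m0 xm] := fin_adele_fracP (x i); exists m.
exists (\prod_i k i)%N => [|i]; first by apply/prodn_gt0 => i; case: (xk i).
by apply: fin_adele_frac_dvd (xk i).2; rewrite (bigD1 i) //= dvdn_mulr.
Qed.

End fin_adele_integral.

(** * Topology of the adeles *)

Section fin_adele_ball.
Implicit Types (x y : fin_adele) (m : nat).

(* The coset x + m Zhat. *)
Definition fin_adele_ball x m : set fin_adele :=
  [set y | forall p, padic_abs (y p - x p) <= padic_abs (m%:R : padic p)].

Lemma fin_adele_ballxx x m : fin_adele_ball x m x.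
Proof. by move=> p; rewrite subrr padic_abs0 padic_abs_ge0. Qed.

Lemma fin_adele_ball1 x : fin_adele_ball x 1 = [set y | y - x \in fin_adele_integral].
Proof.
by apply/seteqP; split=> y /= => [yx|/fin_adele_integralP yx p];
  [apply/fin_adele_integralP => p; have := yx p | have := yx p];
  rewrite unfold_in padic_abs1.
Qed.

Lemma padic_ball_open p (z : padic p) (e : rat) : 0 < e ->
  open [set y | padic_abs (y - z) <= e].
Proof.
move=> e0; rewrite /open /= => y yz; exists e => // w wy.
by rewrite /= -[w](subrK y) -addrA (le_trans (padic_abs_leD _ _)) // ge_max ltW.
Qed.

Lemma fin_adele_ball_open x m : (0 < m)%N -> open (fin_adele_ball x m).
Proof.
move=> m0; rewrite /open /= => y yx.
exists (fun p => [set z | padic_abs (z - x p) <= padic_abs (m%:R : padic p)]).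
split=> // [p|].
  split; [apply: padic_ball_open | exact: yx].
  by rewrite padic_abs_nat // invr_gt0 exprn_gt0 // padic_p_gt0.
have : finite_set ([set p | ~ padic_int p (x p)] `|`
    [set p : primeT | (val p %| m)%N]).
  rewrite finite_setU; split; first exact: fin_adeleP.
  apply: (@sub_finite_set _ _ (val @^-1` [set` primes m])) => [p pm|].
    by rewrite /= mem_primes (valP p) m0.
  by apply: finite_preimage => [p q _ _ /val_inj|]; last exact: finite_seq.
apply: sub_finite_set => p /=; apply: contra_notP => /not_orP[/contrapT xp pm].
have -> : padic_abs (m%:R : padic p) = 1.
  rewrite padic_abs_nat // logn_coprime ?expr0 ?invr1 //.
  by rewrite prime_coprime ?(valP p) //; apply/negP.
apply/funext => z; congr is_true.
exact: (rpredBr z (xp : x p \in padic_integral p)).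
Qed.

Lemma fin_adele_nbhsP x (U : set fin_adele) :
  nbhs x U <-> exists2 m, (0 < m)%N & fin_adele_ball x m `<=` U.
Proof.
split=> [|[m m0]]; last first.
  move=> /filterS; apply; apply: open_nbhs_nbhs; split; last exact: fin_adele_ballxx.
  exact: fin_adele_ball_open.
rewrite nbhsE => -[B [oB /oB[V [Vx fV VB]]] BU].
have /choice[k kV] p : exists k, forall z,
    padic_abs (z - x p) <= (val p)%:R ^- k -> V p z.
  have [/(_ _)/[apply][[e e0 eV]]] := Vx p; have [k ke] := prime_expVn_lt p e0.
  by exists k => z zx; apply: eV; exact: le_lt_trans ke.
have [m m0 km] := multiple_of_prime_powers k fV.
exists m => // y yx; apply/BU/VB => p.
have [/km kp|/contrapT VE] := pselect (V p <> padic_int p).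
  by apply: kV; rewrite (le_trans (yx p)) // padic_abs_nat_le.
have yxZ : y p - x p \in padic_integral p.
  exact: le_trans (yx p) (rpred_nat (padic_integral p) m).
by have [_] := Vx p; rewrite VE -[y p](subrK (x p)); apply: (rpredD yxZ).
Qed.

Lemma fin_adele_nbhs_integral x : nbhs x [set y | y - x \in fin_adele_integral].
Proof. by rewrite -fin_adele_ball1; apply/fin_adele_nbhsP; exists 1%N. Qed.

Lemma fin_adele_frac_open m : open [set` fin_adele_frac m].
Proof.
rewrite openE => x /= xm; apply: filterS (fin_adele_nbhs_integral x) => y /= yx.
by rewrite -[y](subrK x) rpredD // fin_adele_integral_frac.
Qed.

Lemma fin_adele_add_continuous :
  continuous (fun z : fin_adele * fin_adele => z.1 + z.2).
Proof.
move=> [x y] U /= /fin_adele_nbhsP[m m0 mU].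
exists (fin_adele_ball x m, fin_adele_ball y m).
  by split; apply/fin_adele_nbhsP; exists m.
move=> [z t] [/= zx ty]; apply: mU => p /=; rewrite opprD addrACA.
by rewrite (le_trans (padic_abs_leD _ _)) // ge_max zx ty.
Qed.

Lemma fin_adele_mull_continuous x : continuous (fun y => x * y).
Proof.
move=> y U /= /fin_adele_nbhsP[m m0 mU]; have [k k0 kx] := fin_adele_fracP x.
apply/fin_adele_nbhsP; exists (m * k)%N; first by rewrite muln_gt0 m0.
move=> z zy; apply: mU => p /=; rewrite -mulrBr padic_absM.
rewrite (le_trans (ler_wpM2l (padic_abs_ge0 _) (zy p))) //.
rewrite -padic_absM natrM mulrCA [x p * _]mulrC padic_absM ler_piMr ?padic_abs_ge0 //.
by have /fin_adele_integralP/(_ p) := kx; rewrite unfold_in /= fin_adele_natE.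
Qed.

End fin_adele_ball.

Lemma mx_coord_continuous (T : topologicalType) m n i j :
  continuous (fun M : 'M[T]_(m, n) => M i j).
Proof.
move=> M U MU; exists (fun i' j' => [set t | (i', j') = (i, j) -> U t]) => [i' j'|N].
  have [[-> ->]|ij] := eqVneq (i', j') (i, j).
    by apply: filterS MU => t Ut _.
  by apply: nearW => t /eqP; rewrite (negPf ij).
by move=> /(_ i j); apply.
Qed.

Lemma mx_continuousP (S T : topologicalType) m n (g : S -> 'M[T]_(m, n)) :
  (forall i j, continuous (fun x => g x i j)) -> continuous g.
Proof.
move=> gc x U [P MP PU].
have : \forall y \near x, forall ij : 'I_m * 'I_n, P ij.1 ij.2 (g y ij.1 ij.2).
  by apply: filter_forall => ij; exact: gc (MP _ _).
by apply: filterS => y Py; apply: PU => i j; exact: (Py (i, j)).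
Qed.

Lemma map_mx_continuous (S T : topologicalType) m n (f : S -> T) :
  continuous f -> continuous (fun M : 'M[S]_(m, n) => map_mx f M).
Proof.
move=> fc; apply: mx_continuousP => i j M.
rewrite /continuous_at mxE; under eq_cvg do rewrite mxE.
exact: (continuous_comp (@mx_coord_continuous _ _ _ i j M) (fc _)).
Qed.

Lemma topological_cvgD (T : TopologicalNmodule.type) (S : Type) (F : set_system S)
    {FF : Filter F} (f g : S -> T) (a b : T) :
  f @ F --> a -> g @ F --> b -> f x + g x @[x --> F] --> a + b.
Proof.
move=> fa gb; apply: continuous2_cvg fa gb.
exact: (@add_continuous T (a, b)).
Qed.

HB.instance Definition _ := PreTopologicalNmodule_isTopologicalNmodule.Build
  fin_adele fin_adele_add_continuous.

Section adele_topology.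
Variable R : realType.

Lemma adele_add_continuous : continuous (fun z : adele R * adele R => z.1 + z.2).
Proof.
move=> [[x a] [y b]] /= U [[A B] [/= Axy Bab] ABU].
have [[A1 A2] [/= A1x A2y] A12] := @add_continuous R^o (x, y) _ Axy.
have [[B1 B2] [/= B1a B2b] B12] := @add_continuous fin_adele (a, b) _ Bab.
exists (A1 `*` B1, A2 `*` B2); first by split; [exists (A1, B1) | exists (A2, B2)].
move=> [[s t] [s' t']] [[/= A1s B1t] [/= A2s' B2t']].
by apply: ABU; split; [exact: (A12 (s, s')) | exact: (B12 (t, t'))].
Qed.

HB.instance Definition _ := PreTopologicalNmodule_isTopologicalNmodule.Build
  (adele R) adele_add_continuous.

Lemma adele_mull_continuous (a : adele R) : continuous (fun x => a * x).
Proof.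
move=> x U [[A B] [/= Aax Bax] ABU].
exists ((fun s => a.1 * s) @^-1` A, (fun t => a.2 * t) @^-1` B); last first.
  by move=> y [/= Ay By]; apply: ABU.
by split; [exact: mulrl_continuous Aax | exact: fin_adele_mull_continuous Bax].
Qed.

Lemma pi_inf_continuous d : continuous (@pi_inf R d).
Proof. by apply: map_mx_continuous => a; exact: cvg_fst. Qed.

Lemma pi_int_continuous d : continuous (@pi_int R d).
Proof. by apply: map_mx_continuous => a; exact: cvg_snd. Qed.

Lemma ASL_act_continuous d (x : 'rV[adele R]_d) :
  continuous (fun M : ASL d (adele R) => ASL_act x M).
Proof.
apply: mx_continuousP => i j M.
rewrite /continuous_at !mxE; under eq_cvg do rewrite !mxE.
apply: topological_cvgD; last first.
  by apply: (continuous_cvg _ (@mx_coord_continuous _ _ _ i j M.2)); exact: cvg_snd.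
apply: cvg_big => [|k _]; first exact: add_continuous.
apply: (continuous_cvg _ (@adele_mull_continuous _ _)).
apply: (continuous_cvg _ (@mx_coord_continuous _ _ _ k j (val M.1))).
by apply: (continuous_cvg _ (@initial_continuous _ _ _ _)); exact: cvg_fst.
Qed.

End adele_topology.

Lemma mx_translate_continuous (T : TopologicalNmodule.type) m n (v : 'M[T]_(m, n)) :
  continuous (fun x : 'M[T]_(m, n) => x + v).
Proof.
apply: mx_continuousP => i j x.
rewrite /continuous_at mxE; under eq_cvg do rewrite mxE.
exact: topological_cvgD (@mx_coord_continuous _ _ _ i j x) (cvg_cst _).
Qed.

(** * Bounded sets of adeles *)

(* m^-1 Zhat^d *)
Definition frac_window d (m : nat) : set 'rV[fin_adele]_d :=
  [set x : 'rV[fin_adele]_d | forall j, x 0 j \in fin_adele_frac m].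
Arguments frac_window : clear implicits.

Section frac_windows.
Variable d : nat.
Implicit Types (x v : 'rV[fin_adele]_d) (W : set 'rV[fin_adele]_d) (k m : nat).

Lemma frac_window_dvd k m : (k %| m)%N -> frac_window d k `<=` frac_window d m.
Proof. by move=> km x xk j; exact: fin_adele_frac_dvd (xk j). Qed.

Lemma frac_window_open m : open (frac_window d m).
Proof.
rewrite openE => x xm.
apply: (@filter_forall _ _ (fun j y => y 0 j \in fin_adele_frac m) (nbhs x)) => j.
apply: (@mx_coord_continuous _ _ _ 0 j x [set` fin_adele_frac m]).
by apply: open_nbhs_nbhs; split; [exact: fin_adele_frac_open | exact: xm].
Qed.

Definition fin_adele_bounded W := exists2 m, (0 < m)%N & W `<=` frac_window d m.

Lemma compact_fin_adele_bounded W : compact W -> fin_adele_bounded W.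
Proof.
move=> /compact_near_coveringP cW.
have [|m _ mW] := cW nat \oo (fun m => frac_window d m`!) _; last first.
  by exists m`!; [exact: fact_gt0 | exact: mW (leqnn m)].
move=> x _; have [m m0 xm] := fin_adele_frac_fin (x 0).
exists (frac_window d m, [set k | (m <= k)%N]); last first.
  move=> [y k] [/= ym mk]; apply: frac_window_dvd ym.
  by rewrite dvdn_fact // m0.
by split; [apply: open_nbhs_nbhs; split; [exact: frac_window_open |] | exists m].
Qed.

Lemma fin_adele_bounded_translate W v :
  fin_adele_bounded W -> fin_adele_bounded [set w - v | w in W].
Proof.
move=> [m m0 Wm]; have [k k0 vk] := fin_adele_frac_fin (v 0).
exists (m * k)%N => [|_ [w /Wm wm <-] j]; first by rewrite muln_gt0 m0.
rewrite !mxE rpredB //.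
  by apply: fin_adele_frac_dvd (wm j); rewrite dvdn_mulr.
by apply: fin_adele_frac_dvd (vk j); rewrite dvdn_mull.
Qed.

End frac_windows.

Section adele_bounded_on.
Variables (R : realType) (T : Type) (A : set T).
Implicit Types f g : T -> adele R.

Definition adele_bounded_on f := exists (B : R) (m : nat), (0 < m)%N /\
  forall t, A t -> `|(f t).1| <= B /\ (f t).2 \in fin_adele_frac m.

Lemma adele_bounded_cst a : adele_bounded_on (fun=> a).
Proof. by have [m m0 am] := fin_adele_fracP a.2; exists `|a.1|, m. Qed.

Lemma adele_boundedD f g : adele_bounded_on f -> adele_bounded_on g ->
  adele_bounded_on (fun t => f t + g t).
Proof.
move=> [B [m [m0 fm]]] [C [k [k0 gk]]]; exists (B + C), (m * k)%N.
split=> [|t At]; first by rewrite muln_gt0 m0.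
have [[fB ftm] [gC gtk]] := (fm t At, gk t At); split.
  by rewrite (le_trans (ler_normD _ _)) // lerD.
apply: rpredD; first exact: fin_adele_frac_dvd (dvdn_mulr k (dvdnn m)) ftm.
exact: fin_adele_frac_dvd (dvdn_mull m (dvdnn k)) gtk.
Qed.

Lemma adele_boundedM f g : adele_bounded_on f -> adele_bounded_on g ->
  adele_bounded_on (fun t => f t * g t).
Proof.
move=> [B [m [m0 fm]]] [C [k [k0 gk]]]; exists (B * C), (m * k)%N.
split=> [|t At]; first by rewrite muln_gt0 m0.
have [[fB ftm] [gC gtk]] := (fm t At, gk t At); split.
  by rewrite normrM ler_pM.
exact: fin_adele_fracM.
Qed.

Lemma adele_bounded_sum (I : finType) (F : I -> T -> adele R) :
  (forall i, adele_bounded_on (F i)) -> adele_bounded_on (fun t => \sum_i F i t).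
Proof.
move=> Fb; elim: index_enum => [|i s sb].
  under eq_fun do rewrite big_nil; exact: adele_bounded_cst.
by under eq_fun do rewrite big_cons; exact: adele_boundedD.
Qed.

Lemma adele_bounded_rat_finite (a : T -> rat) :
  adele_bounded_on (fun t => adele_of_rat R (a t)) -> finite_set (a @` A).
Proof.
move=> [B [m [m0 am]]]; pose N := Num.bound (m%:R * B).
apply: (@sub_finite_set _ _ ((fun k : nat => (k%:R / m%:R : rat)) @` `I_N `|`
    (fun k : nat => - (k%:R / m%:R : rat)) @` `I_N)); last first.
  by rewrite finite_setU; split; apply: finite_image; exact: finite_II.
move=> _ [t /am[/= tB tm] <-]; move: tm.
rewrite fin_adele_frac_of_rat => /intrP[z mz].
have aE : a t = z%:~R / m%:R.
  by rewrite -mz mulrC mulKf // pnatr_eq0 -lt0n.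
have zN : (`|z| < N)%N.
  rewrite -(ltr_nat R); apply: (@le_lt_trans _ _ (m%:R * B)).
    rewrite natr_absz intr_norm -(ratr_int R) -mz rmorphM /= normrM.
    by rewrite ratr_nat normr_nat ler_wpM2l.
  by apply: archi_boundP; rewrite mulr_ge0 // (le_trans _ tB).
have [z0|z0] := lerP 0 z; [left | right]; exists `|z|%N => //.
  by rewrite aE natr_absz ger0_norm.
by rewrite aE natr_absz ltr0_norm // intrN mulNr opprK.
Qed.

End adele_bounded_on.

Lemma finite_mx_coord (T : choiceType) m n (A : set 'M[T]_(m, n)) :
  (forall i j, finite_set [set x i j | x in A]) -> finite_set A.
Proof.
move=> fA; have /finite_seqP[s sE] :
    finite_set (\bigcup_(ij in [set: 'I_m * 'I_n]) [set x ij.1 ij.2 | x in A]).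
  by apply: bigcup_finite => [|ij _]; [exact: finite_finset | exact: fA].
pose mx_of (f : {ffun 'I_m * 'I_n -> seq_sub s}) : 'M[T]_(m, n) :=
  \matrix_(i, j) val (f (i, j)).
have : finite_set (mx_of @` setT) by apply: finite_image; exact: finite_finset.
apply: sub_finite_set => x Ax.
have xs ij : x ij.1 ij.2 \in s.
  suff : [set` s] (x ij.1 ij.2) by [].
  by rewrite -sE; exists ij => //; exists x.
exists [ffun ij => SeqSub (xs ij)] => //.
by apply/matrixP => i j; rewrite mxE ffunE.
Qed.

Section norm2.
Variables (R : realType) (n : nat).
Implicit Types x : 'rV[R]_n.

Lemma norm2_ge0 x : 0 <= norm2 x.
Proof. exact: sqrtr_ge0. Qed.

Lemma norm2_coord x i : `|x 0 i| <= norm2 x.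
Proof.
rewrite -sqrtr_sqr ler_wsqrtr // (bigD1 i) //= lerDl.
by apply: sumr_ge0 => j _; exact: sqr_ge0.
Qed.

Lemma norm2_continuous : continuous (@norm2 R n).
Proof.
have sum_sqr_continuous : continuous (fun x : 'rV[R]_n => \sum_i x 0 i ^+ 2).
  apply: continuous_big => [|i _ x]; first exact: (@add_continuous R^o).
  exact: (continuous_comp (@mx_coord_continuous _ _ _ 0 i x) (@exprn_continuous _ 2 _)).
by move=> x; exact: (continuous_comp (sum_sqr_continuous x) (@sqrt_continuous R _)).
Qed.

End norm2.

Section adele_projections.
Variables (R : realType) (d : nat).
Implicit Types x y : 'rV[adele R]_d.

Lemma pi_infD x y : pi_inf (x + y) = pi_inf x + pi_inf y.
Proof. exact: (map_mxD fst). Qed.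

Lemma pi_inf_mulmx x (A : 'M[adele R]_d) :
  pi_inf (x *m A) = pi_inf x *m map_mx fst A.
Proof. exact: (map_mxM fst). Qed.

Lemma pi_int_mulmx x (A : 'M[adele R]_d) :
  pi_int (x *m A) = pi_int x *m map_mx snd A.
Proof. exact: (map_mxM snd). Qed.

End adele_projections.

Section windows.
Variables (R : realType) (d : nat).
Implicit Types (K : set 'rV[R]_d) (W : set 'rV[fin_adele]_d).

Definition window K W : set 'rV[adele R]_d := [set x | K (pi_inf x) /\ W (pi_int x)].

Lemma windowS K K' W W' : K `<=` K' -> W `<=` W' -> window K W `<=` window K' W'.
Proof. by move=> KK' WW' x [/KK' Kx /WW' Wx]. Qed.

Lemma window_open K W : open K -> open W -> open (window K W).
Proof.
move=> oK oW; apply: (@openI _ (@pi_inf R d @^-1` K) (@pi_int R d @^-1` W)).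
  by apply: open_comp => // x _; exact: pi_inf_continuous.
by apply: open_comp => // x _; exact: pi_int_continuous.
Qed.

Lemma cut_projectE (L : set 'rV[adele R]_d) K W :
  cut_project L W `&` K = @pi_inf R d @` (L `&` window K W).
Proof.
apply/seteqP; split=> [_ [[x [Lx Wx] <-] Kx]|_ [x [Lx [Kx Wx]] <-]].
  by exists x.
by split=> //; exists x.
Qed.

Lemma ASL_act_bounded_finite (M : ASL d (adele R)) (B : R) m : (0 < m)%N ->
  finite_set [set q | window [set x | norm2 x < B] (frac_window d m)
    (ASL_act (delta R q) M)].
Proof.
move=> m0; apply: finite_mx_coord => i j; rewrite [i]ord1 {i}.
set A := (X in _ @` X).
have coord_bounded i : adele_bounded_on A (fun q => ASL_act (delta R q) M 0 i).
  exists B, m; split=> // q [/= qB qm]; split; last by have := qm i; rewrite mxE.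
  by have := norm2_coord (pi_inf (ASL_act (delta R q) M)) i; rewrite mxE; lra.
apply: (@adele_bounded_rat_finite R _ A (fun q : 'rV[rat]_d => q 0 j)).
have deltaE (q : 'rV[rat]_d) : adele_of_rat R (q 0 j) =
    \sum_i (ASL_act (delta R q) M 0 i - M.2 0 i) * (\adj (val M.1)) i j.
  have : (ASL_act (delta R q) M - M.2) *m \adj (val M.1) = delta R q.
    by rewrite /ASL_act addrK -mulmxA mul_mx_adj SL_det mulmx1.
  move=> /rowP/(_ j); rewrite [RHS]mxE => <-.
  by rewrite mxE; apply: eq_bigr => i _; rewrite !mxE.
under eq_fun do rewrite deltaE.
apply: adele_bounded_sum => i; apply: adele_boundedM; last exact: adele_bounded_cst.
by apply: adele_boundedD; last exact: adele_bounded_cst.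
Qed.

Lemma pi_inf_ASL_act_inj (M : ASL d (adele R)) :
  injective (fun q => pi_inf (ASL_act (delta R q) M)).
Proof.
have deltaE q : (pi_inf (ASL_act (delta R q) M) - pi_inf M.2) *m
    map_mx fst (\adj (val M.1)) = pi_inf (delta R q).
  rewrite /ASL_act pi_infD (addrK (pi_inf M.2)) -pi_inf_mulmx -mulmxA.
  by rewrite mul_mx_adj SL_det mulmx1.
move=> q q' /= eq_pt; have := deltaE q; rewrite eq_pt (deltaE q') => /rowP qq'.
by apply/rowP => i; have := qq' i; rewrite !mxE /= => /fmorph_inj.
Qed.

End windows.

Section SL_real.
Variables (R : realType) (d : nat).

Definition adele_of_real_mx (M : 'M[R]_d) : 'M[adele R]_d :=
  \matrix_(i, j) (M i j, (i == j)%:R).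

Lemma fst_adele_of_real_mx M : map_mx fst (adele_of_real_mx M) = M.
Proof. by apply/matrixP => i j; rewrite !mxE. Qed.

Lemma snd_adele_of_real_mx M : map_mx snd (adele_of_real_mx M) = 1%:M.
Proof. by apply/matrixP => i j; rewrite !mxE. Qed.

Lemma SL_real_subproof (M : SL d R) : \det (adele_of_real_mx (val M)) = 1.
Proof.
apply: injective_projections => /=.
  by rewrite -(det_map_mx fst) fst_adele_of_real_mx SL_det.
by rewrite -(det_map_mx snd) snd_adele_of_real_mx det1.
Qed.

Definition SL_real (M : SL d R) : SL d (adele R) := SL_of (SL_real_subproof M).

Lemma pi_inf_SL_real (x : 'rV[adele R]_d) (M : SL d R) :
  pi_inf (x *m val (SL_real M)) = pi_inf x *m val M.
Proof. by rewrite pi_inf_mulmx fst_adele_of_real_mx. Qed.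

Lemma pi_int_SL_real (x : 'rV[adele R]_d) (M : SL d R) :
  pi_int (x *m val (SL_real M)) = pi_int x.
Proof. by rewrite pi_int_mulmx snd_adele_of_real_mx mulmx1. Qed.

End SL_real.

(** * Counting points of configurations *)

Section cardinality.
Local Open Scope card_scope.

Lemma card_II_leP (T : Type) (A : set T) r :
  (`I_r #<= A) <-> exists2 s : 'I_r -> T, injective s & forall i, A (s i).
Proof.
split=> [/card_leP[g]|[s s_inj sA]].
  pose s (i : 'I_r) := g (SigSub (mem_set (ltn_ord i : `I_r i))).
  exists (val \o s) => [i j /val_inj gij|i]; last exact: set_valP.
  by apply: val_inj; have /(congr1 val) := @inj _ _ _ g _ _ (in_setT _) (in_setT _) gij.
have s_injT : {in [set: 'I_r] &, injective s} by move=> i j _ _ /s_inj.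
rewrite (card_le_eql card_II) -(card_le_eql (inj_card_eq s_injT)).
by apply: subset_card_le => _ [i _ <-]; exact: sA.
Qed.

Variable R : realType.

Lemma counting_card_II (T : choiceType) (A : set T) r :
  (counting A = r%:R%:E :> \bar R) <-> (A #= `I_r).
Proof.
rewrite /counting; case: asboolP => fA; last first.
  by split=> // Ar; case: fA; apply/finite_setP; exists r.
split=> [[] /eqP|Ar]; last by rewrite (card_fset_set Ar).
by rewrite eqr_nat => /eqP Ar; rewrite -[A]fset_setK //; apply/card_eq_fsetP.
Qed.

Lemma lte_counting (T : choiceType) (A : set T) (a : R) :
  (a%:E < counting A)%E <-> exists2 r, a < r%:R & `I_r #<= A.
Proof.
have [fA|iA] := pselect (finite_set A).
  have [r rA] := (finite_setP _).1 fA; rewrite ((counting_card_II A r).2 rA) lte_fin.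
  split=> [ar|[k ak kA]]; first by exists r => //; rewrite (card_le_eqr rA).
  by apply: lt_le_trans ak _; rewrite ler_nat -card_le_II -(card_le_eqr rA).
rewrite /counting asboolF // ltry; split=> // _.
exists (Num.bound `|a|); first by rewrite (le_lt_trans (ler_norm a)) // archi_boundP.
by apply: (card_le_trans _ ((infiniteP _).1 iA)); exact: subset_card_le.
Qed.

End cardinality.

Lemma borel_open (T : ptopologicalType) (U : set (borel T)) : @open T U -> measurable U.
Proof. by move=> oU; apply: sub_sigma_algebra. Qed.

Lemma borel_closed (T : ptopologicalType) (F : set (borel T)) :
  @closed T F -> measurable F.
Proof.
move=> cF; rewrite -[F]setCK; apply: measurableC; apply: borel_open.
exact: closed_openC.
Qed.

Lemma borel_preimage (S T : ptopologicalType) (g : S -> T) (B : set (borel T)) :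
  continuous g -> measurable B -> measurable (g @^-1` B : set (borel S)).
Proof.
move=> gc mB; have mg : measurable_fun (setT : set (borel S)) (g : borel S -> borel T).
  apply: (measurability (@open T : set (set (borel T))) erefl) => _ [U oU <-].
  by rewrite setTI; apply: borel_open; apply: open_comp => // x _; exact: gc.
by have := mg measurableT B mB; rewrite setTI.
Qed.

Lemma borel_measurable_lsc (R : realType) (T : ptopologicalType)
    (h : borel T -> \bar R) :
  (forall a : R, open [set x : T | (a%:E < h x)%E]) -> measurable_fun setT h.
Proof.
move=> oh; apply: (measurability _ (ErealGenOInfty.measurableE R)).
move=> /= _ [_ [a ->]] <-; rewrite setTI preimage_itvoy.
exact: borel_open (oh a).
Qed.

(* The next two lemmas restate library ones for [borel T], because unification is
   very slow when they are applied directly to functions on a coset space. *)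
Lemma borel_measurable_funB (R : realType) (T : ptopologicalType)
    (g h : borel T -> \bar R) :
  measurable_fun setT g -> measurable_fun setT h -> measurable_fun setT (g \- h)%E.
Proof. exact: emeasurable_funB. Qed.

Lemma borel_measurable_series (R : realType) (T : ptopologicalType)
    (h : nat -> borel T -> \bar R) :
  (forall k x, 0 <= h k x)%E -> (forall k, measurable_fun setT (h k)) ->
  measurable_fun setT (fun x => \sum_(k <oo) h k x)%E.
Proof. by move=> h0 mh; apply: ge0_emeasurable_sum => [k x _ _|k _]. Qed.

Lemma probability_dist_le d (T : measurableType d) (R : realType)
    (P : probability T R) (A B C : set T) :
  measurable A -> measurable B -> measurable C ->
  A `<=` B `|` C -> B `<=` A `|` C ->
  `|fine (P A) - fine (P B)| <= fine (P C).
Proof.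
move=> mA mB mC AB BA.
have fine_leU (D E : set T) : measurable D -> measurable E -> D `<=` E `|` C ->
    fine (P D) <= fine (P E) + fine (P C).
  move=> mD mE DE; rewrite -fineD ?fin_num_measure //.
  rewrite fine_le ?fin_numD ?fin_num_measure //.
  apply: le_trans (measureU2 P mE mC); apply: le_measure; rewrite ?inE //.
  exact: measurableU.
by have := fine_leU _ _ mA mB AB; have := fine_leU _ _ mB mA BA; rewrite ler_norml; lra.
Qed.

Lemma measurable_window (R : realType) d (K : set 'rV[R]_d) (W : set 'rV[fin_adele]_d) :
  measurable (K : set (borel 'rV[R]_d)) ->
  measurable (W : set (borel 'rV[fin_adele]_d)) ->
  measurable (window K W : set (borel 'rV[adele R]_d)).
Proof.
move=> mK mW; apply: (@measurableI _ (borel 'rV[adele R]_d)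
  (@pi_inf R d @^-1` K) (@pi_int R d @^-1` W)).
  exact: borel_preimage (@pi_inf_continuous R d) mK.
exact: borel_preimage (@pi_int_continuous R d) mW.
Qed.

Section coset_lift.
Context (H : groupType) (G : preTopologicalGroupType) (f : UMagmaMorphism.type H G).

Definition coset_lift (x : coset_space f) : G :=
  repr (x : {eq_quot (coset_rel f)}%qT).

Lemma coset_liftK x : coset_proj f (coset_lift x) = x.
Proof. exact: reprK. Qed.

Lemma coset_projP (M M' : G) :
  coset_proj f M = coset_proj f M' <-> exists h, M' = (f h * M)%g.
Proof. by split=> [/eqmodP/asboolP //|h]; apply/eqmodP/asboolP. Qed.

End coset_lift.

(* A family of points pt i M, permuted by the left action of H: it is the
   configuration [set pt i M | i in setT], and not its labelling, that depends
   on the coset of M only. *)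
Section orbit_points.
Context (R : realType) (H : groupType) (G : preTopologicalGroupType).
Context (f : UMagmaMorphism.type H G) (I : countType) (Y : ptopologicalType).
Variable pt : I -> G -> Y.
Hypothesis pt_continuous : forall i, continuous (pt i).
Hypothesis pt_coset : forall h, exists2 tau : I -> I, bijective tau &
  forall i M, pt i (f h * M)%g = pt (tau i) M.
Implicit Types (E F : set Y) (M : G) (mu : probability (borel (coset_space f)) R).

Definition hits E M : set I := [set i | E (pt i M)].

Definition finite_hits_near E := exists U,
  [/\ open U, E `<=` U & forall M, finite_set (hits U M)].

Lemma finite_hits_near_sub E F : E `<=` F -> finite_hits_near F -> finite_hits_near E.
Proof. by move=> EF [U [oU FU fU]]; exists U; split=> // y /EF/FU. Qed.

Lemma finite_hits E M : finite_hits_near E -> finite_set (hits E M).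
Proof. by move=> [U [_ EU fU]]; apply: sub_finite_set (fU M) => i /EU. Qed.

Lemma hits_coset E h M : (hits E (f h * M)%g #= hits E M)%card.
Proof.
have [tau [g tauK gK] ptE] := pt_coset h.
rewrite card_eq_sym (_ : hits E M = tau @` hits E (f h * M)%g).
  by apply: inj_card_eq => i j _ _; exact: can_inj tauK _ _.
apply/seteqP; split=> [i Ei|_ [i Ei <-]]; last by move: Ei; rewrite /hits /= ptE.
by exists (g i); rewrite ?gK // /hits /= ptE gK.
Qed.

Lemma hits_lift E M : (hits E (coset_lift (coset_proj f M)) #= hits E M)%card.
Proof.
have /coset_projP[h ->] := esym (coset_liftK (coset_proj f M)).
exact: hits_coset.
Qed.

Definition count_event E r : set (borel (coset_space f)) :=
  [set x | (hits E (coset_lift x) #= `I_r)%card].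

Definition hit_event E : set (borel (coset_space f)) :=
  [set x | hits E (coset_lift x) !=set0].

Lemma count_eventE E r :
  count_event E r = [set coset_proj f M | M in [set M | (hits E M #= `I_r)%card]].
Proof.
apply/seteqP; split=> [x xr|_ [M Mr <-]]; last exact: card_eq_trans (hits_lift E M) Mr.
by exists (coset_lift x); [exact: xr | exact: coset_liftK].
Qed.

Lemma hit_eventE E : hit_event E = ~` count_event E 0.
Proof.
by apply/seteqP; split=> x; rewrite /count_event /= II0 card_eq0;
  [move=> /set0P/negP | move=> /negP/set0P].
Qed.

Lemma hit_eventP E M : hit_event E (coset_proj f M) <-> hits E M !=set0.
Proof.
rewrite hit_eventE /setC /count_event /= (card_eql (hits_lift E M)) II0 card_eq0.
by split=> [/negP/set0P|/set0P/negP].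
Qed.

Lemma hit_eventS E F : E `<=` F -> hit_event E `<=` hit_event F.
Proof. by move=> EF x [i /EF Fi]; exists i. Qed.

Definition hit_count E (x : borel (coset_space f)) : \bar R :=
  counting (pickle @` hits E (coset_lift x)).

Lemma card_pickle_hits E M : (pickle @` hits E M #= hits E M)%card.
Proof. by apply: inj_card_eq => i j _ _; exact: (pcan_inj pickleK). Qed.

Lemma hit_countP E x r : hit_count E x = r%:R%:E <-> count_event E r x.
Proof.
by rewrite counting_card_II /count_event /= (card_eql (card_pickle_hits _ _)).
Qed.

Lemma hit_count_setU E F x : E `&` F = set0 ->
  hit_count (E `|` F) x = (hit_count E x + hit_count F x)%E.
Proof.
move=> EF; rewrite /hit_count -measureU //=; last first.
  rewrite -subset0 => _ [[i Ei <-] [j Fj /(pcan_inj pickleK) ji]].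
  rewrite ji in Fj; suff : (E `&` F) (pt i (coset_lift x)) by rewrite EF.
  by split; [exact: Ei | exact: Fj].
by rewrite -image_setU.
Qed.

Lemma hit_count_setD E F x : finite_set (hits F (coset_lift x)) -> F `<=` E ->
  hit_count (E `\` F) x = (hit_count E x - hit_count F x)%E.
Proof.
move=> /finite_setP[r /hit_countP Fr] FE.
have disj : (E `\` F) `&` F = set0 by rewrite setIC setDIK.
by have := hit_count_setU x disj; rewrite setDKU // Fr => ->; rewrite addeK.
Qed.

Lemma hit_count_bigcup (F : nat -> set Y) x : trivIset setT F ->
  hit_count (\bigcup_k F k) x = (\sum_(k <oo) hit_count (F k) x)%E.
Proof.
move=> /trivIsetP tF; rewrite /hit_count -measure_semi_bigcup //.
  by rewrite -image_bigcup.
apply/trivIsetP => j k _ _ jk; rewrite -subset0.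
move=> _ [[i Fi <-] [i' Fi' /(pcan_inj pickleK) ii']]; rewrite {}ii' in Fi'.
suff : (F j `&` F k) (pt i (coset_lift x)) by rewrite tF.
by split; [exact: Fi | exact: Fi'].
Qed.

Lemma measurable_hit_count_open E : open E -> finite_hits_near E ->
  measurable_fun setT (hit_count E).
Proof.
move=> oE fE; apply: borel_measurable_lsc => a; rewrite /open /= /quotient_open.
pose many r := [set M | (`I_r #<= hits E M)%card].
rewrite (_ : _ @^-1` _ = \bigcup_(r in [set r | a < r%:R]) many r); last first.
  apply/seteqP; split=> [M /lte_counting[r ar rM]|M [r ar rM]].
    exists r => //.
    rewrite /many /= -(card_le_eqr (hits_lift E M)).
    by rewrite -(card_le_eqr (card_pickle_hits _ _)).
  apply/lte_counting; exists r => //.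
  by rewrite (card_le_eqr (card_pickle_hits _ _)) (card_le_eqr (hits_lift E M)).
apply: bigcup_open => r _; rewrite openE => M /card_II_leP[s s_inj sE].
have : \forall M' \near M, forall i, E (pt (s i) M').
  apply: filter_forall => i; apply: (@pt_continuous (s i) M E).
  by apply: open_nbhs_nbhs; split=> //; exact: sE.
by apply: filterS => M' sE'; apply/card_II_leP; exists s.
Qed.

(* Dynkin's lemma, starting from open sets, for which the counting function is
   lower semicontinuous. *)
Lemma measurable_hit_count (E : set (borel Y)) : measurable E -> finite_hits_near E ->
  measurable_fun setT (hit_count E).
Proof.
move=> mE [U [oU EU fU]].
have near_subU F : F `<=` U -> finite_hits_near F by move=> FU; exists U.
have mU : measurable_fun setT (hit_count U).
  by apply: measurable_hit_count_open => //; exact: near_subU.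
suff : measurable_fun setT (hit_count (E `&` U)) by rewrite setIidl.
move: E mE {EU}; apply: (@dynkin_induction _ (borel Y) (@open Y)
    (fun E => measurable_fun setT (hit_count (E `&` U)))) => //.
- exact: openI.
- by rewrite setTI.
- move=> E oE; apply: measurable_hit_count_open; first exact: openI.
  by apply: near_subU; exact: subIsetr.
- move=> E mE mEU.
  rewrite (_ : hit_count _ = hit_count U \- hit_count (E `&` U))%E.
    exact: borel_measurable_funB.
  apply/funext => x; rewrite -hit_count_setD; last exact: subIsetr.
    by rewrite setDIr setDv setU0 setIC.
  by apply: finite_hits; apply: near_subU; exact: subIsetr.
- move=> F mF tF mFU; rewrite setI_bigcupl.
  rewrite (_ : hit_count _ = fun x => (\sum_(k <oo) hit_count (F k `&` U) x)%E).
    by apply: borel_measurable_series => // k x; exact: measure_ge0.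
  apply/funext => x; apply: hit_count_bigcup.
  exact: trivIset_setIr.
Qed.

Lemma measurable_count_event (E : set (borel Y)) r :
  measurable E -> finite_hits_near E -> measurable (count_event E r).
Proof.
move=> mE fE; have := measurable_hit_count mE fE measurableT (emeasurable_set1 r%:R%:E).
by rewrite setTI; congr measurable; apply/seteqP; split=> x /hit_countP.
Qed.

Lemma measurable_hit_event (E : set (borel Y)) :
  measurable E -> finite_hits_near E -> measurable (hit_event E).
Proof.
by move=> mE fE; rewrite hit_eventE; apply: measurableC; exact: measurable_count_event.
Qed.

Lemma hit_event_bigcap (E : nat -> set Y) :
  nonincreasing_seq E -> finite_hits_near (E 0) ->
  hit_event (\bigcap_k E k) = \bigcap_k hit_event (E k).
Proof.
move=> E_ni fE0; apply/seteqP; split=> [x [i Ei] k _|x Ex].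
  by exists i; exact: Ei.
apply: contrapT => /forallNP none.
have /choice[k Ek] i : exists k, ~ E k (pt i (coset_lift x)).
  by apply: contrapT => /forallNP Ei; apply: (none i) => k _; exact: contrapT (Ei k).
have [s sE] := (finite_seqP _).1 (finite_hits (coset_lift x) fE0).
have [i Ei] := Ex (\max_(i <- s) k i)%N Logic.I.
have E_sub m n : (m <= n)%N -> E n `<=` E m by move=> /E_ni/subsetPset.
have s_i : [set` s] i by rewrite -sE; exact: E_sub Ei.
by apply: (Ek i); apply: E_sub Ei; exact: leq_bigmax_seq.
Qed.

Lemma hit_event_cvg mu (E : nat -> set (borel Y)) : (forall k, measurable (E k)) ->
  nonincreasing_seq E -> finite_hits_near (E 0) ->
  mu (hit_event (E k)) @[k --> \oo] --> mu (hit_event (\bigcap_k E k)).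
Proof.
move=> mE E_ni fE0; rewrite hit_event_bigcap //.
have mhE k : measurable (hit_event (E k)).
  apply: measurable_hit_event => //; apply: finite_hits_near_sub fE0.
  exact/subsetPset/E_ni.
apply: nonincreasing_cvg_mu => //.
- by rewrite (le_lt_trans (probability_le1 _ (mhE _))) // ltry.
- exact: bigcapT_measurable.
- by move=> m n /E_ni/subsetPset mn; apply/subsetPset; exact: hit_eventS.
Qed.

Lemma hit_event_translate mu (E F : set (borel Y)) g : right_invariant mu ->
  measurable E -> finite_hits_near E ->
  (forall i M, F (pt i (M * g)%g) <-> E (pt i M)) ->
  mu (hit_event F) = mu (hit_event E).
Proof.
move=> mu_inv mE fE FE; rewrite -[RHS](mu_inv g); last exact: measurable_hit_event.
congr (mu _); apply/seteqP; split=> [x|_ [M /hit_eventP[i Ei] <-]]; last first.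
  by apply/hit_eventP; exists i; apply/FE.
rewrite -[x]coset_liftK => /hit_eventP[i Fi].
exists (coset_lift x * g^-1)%g; last by rewrite mulgVK.
by apply/hit_eventP; exists i; apply/FE; rewrite mulgVK.
Qed.

(* Disjoint sets that are hit with equal probability p: the union of a tail of the
   sequence is hit with probability at least p, but these unions decrease to the
   empty set. *)
Lemma wandering_hit_null mu (E : nat -> set (borel Y)) (p : \bar R) :
  (forall k, measurable (E k)) -> trivIset setT E ->
  finite_hits_near (\bigcup_k E k) -> (forall k, mu (hit_event (E k)) = p) -> p = 0%E.
Proof.
move=> mE /trivIsetP tE fE Ep.
pose tail n := \bigcup_(k in [set k | (n <= k)%N]) E k.
have tail_ni : nonincreasing_seq tail.
  move=> m n mn; apply/subsetPset => y [k /= nk Eky].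
  by exists k => //; exact: leq_trans mn nk.
have tail_fin n : finite_hits_near (tail n).
  by apply: finite_hits_near_sub fE => y [k _ Eky]; exists k.
have m_tail n : measurable (tail n : set (borel Y)) by exact: bigcup_measurable.
have tail0 : \bigcap_n tail n = set0.
  rewrite -subset0 => y tail_y; have [k _ Eky] := tail_y 0%N Logic.I.
  have [l kl Ely] := tail_y k.+1 Logic.I.
  by rewrite -(tE k l) //; rewrite /= in kl; rewrite ltn_eqF.
apply/eqP; rewrite eq_le -{2}(Ep 0%N) measure_ge0 andbT.
have := @hit_event_cvg mu _ m_tail tail_ni (tail_fin 0%N).
rewrite tail0 (_ : hit_event set0 = set0) ?measure0; last first.
  by apply/seteqP; split=> // x [].
apply: cvge_ge; apply: nearW => n; rewrite -(Ep n).
apply: le_measure; rewrite ?inE; try exact: measurable_hit_event.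
  apply: measurable_hit_event => //; apply: finite_hits_near_sub fE; exact: bigcup_sup.
by apply: hit_eventS => y Eny; exists n => /=.
Qed.

Lemma count_event_diff E F r : count_event E r `<=`
  count_event F r `|` hit_event ((E `\` F) `|` (F `\` E)).
Proof.
move=> x xr; apply: contrapT => /not_orP[nFr nhit]; apply: nFr.
rewrite /count_event /= (_ : hits F _ = hits E (coset_lift x)) //.
apply/seteqP; split=> i Hi; apply: contrapT => nHi; apply: nhit; exists i;
  [by right | by left].
Qed.

Lemma count_event_dist mu (E F D : set (borel Y)) r :
  measurable E -> measurable F -> measurable D ->
  finite_hits_near E -> finite_hits_near F -> finite_hits_near D ->
  (E `\` F) `|` (F `\` E) `<=` D ->
  `|fine (mu (count_event E r)) - fine (mu (count_event F r))| <=
    fine (mu (hit_event D)).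
Proof.
move=> mE mF mD fE fF fD EFD.
apply: probability_dist_le.
- exact: measurable_count_event.
- exact: measurable_count_event.
- exact: measurable_hit_event.
- by move=> x /(count_event_diff F)[|/(hit_eventS EFD)]; [left | right].
- move=> x /(count_event_diff E)[|]; first by left.
  by rewrite setUC => /(hit_eventS EFD); right.
Qed.

Lemma count_event_continuous mu (T : topologicalType) (E : T -> set (borel Y)) (t : T)
    (D : nat -> set (borel Y)) r :
  (forall s, measurable (E s)) -> (forall s, finite_hits_near (E s)) ->
  (forall k, measurable (D k)) -> nonincreasing_seq D -> finite_hits_near (D 0) ->
  (forall k, \forall s \near t, (E t `\` E s) `|` (E s `\` E t) `<=` D k) ->
  mu (hit_event (\bigcap_k D k)) = 0%E ->
  {for t, continuous (fun s => fine (mu (count_event (E s) r)))}.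
Proof.
move=> mE fE mD D_ni fD ED D0; apply/cvgrPdist_le => e e0.
have : fine (mu (hit_event (D k))) @[k --> \oo] --> (0 : R).
  by apply: fine_cvg; rewrite -[0%:E]D0; exact: hit_event_cvg.
move=> /cvgrPdist_le/(_ e e0)[k _ /(_ k (leqnn k))] /=.
rewrite sub0r normrN => /(le_trans (ler_norm _)) Dk.
apply: filterS (ED k) => s EsD; apply: le_trans Dk; apply: count_event_dist => //.
by apply: finite_hits_near_sub fD; exact/subsetPset/D_ni.
Qed.

End orbit_points.

(** * Cones *)

Section shell.
Variables (R : realType) (n : nat).
Implicit Types (c a lo hi rho : R) (x : 'rV[R]_n.+1).

Lemma norm2_col'_continuous : continuous (fun x => norm2 (col' 0 x)).
Proof.
move=> x; apply: (@continuous_comp _ _ _ (fun x => col' 0 x) (@norm2 R n)).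
  apply: (mx_continuousP (g := fun x => col' 0 x)) => i j y.
  rewrite /continuous_at mxE; under eq_cvg do rewrite mxE.
  exact: mx_coord_continuous.
exact: norm2_continuous.
Qed.

Lemma norm2_le_head_col' x : norm2 x <= `|x 0 0| + norm2 (col' 0 x).
Proof.
have tail0 := norm2_ge0 (col' 0 x).
rewrite -(@ger0_norm _ (_ + _)) ?addr_ge0 // -sqrtr_sqr ler_wsqrtr //.
rewrite big_ord_recl sqrrD real_normK ?num_real // [in leRHS]sqr_sqrtr; last first.
  by apply: sumr_ge0 => i _; exact: sqr_ge0.
under [X in _ <= _ + X]eq_bigr do rewrite mxE.
by rewrite lerD2r lerDl mulrn_wge0 // mulr_ge0.
Qed.

(* The factor a makes the class of shells stable under [stretch] below. *)
Definition shell c a lo hi : set 'rV[R]_n.+1 := [set x : 'rV[R]_n.+1 |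
  c < a * x 0 0 < 1 /\ lo * x 0 0 <= norm2 (col' 0 x) <= hi * x 0 0].

Lemma measurable_shell c a lo hi :
  measurable (shell c a lo hi : set (borel 'rV[R]_n.+1)).
Proof.
have head_continuous b : continuous (fun x : 'rV[R]_n.+1 => b * x 0 0).
  move=> x; apply: (@continuous_comp _ _ _ (fun x : 'rV[R]_n.+1 => x 0 0) ( *%R b)).
    exact: mx_coord_continuous.
  exact: mulrl_continuous.
have -> : shell c a lo hi = (fun x => a * x 0 0) @^-1` `]c, 1[ `&`
    ((fun x => norm2 (col' 0 x) - lo * x 0 0) @^-1` [set t | 0 <= t] `&`
     (fun x => hi * x 0 0 - norm2 (col' 0 x)) @^-1` [set t | 0 <= t]).
  apply/seteqP; split=> x /=; rewrite in_itv /= !subr_ge0.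
    by move=> [? /andP[? ?]].
  by move=> [? [? ?]]; split=> //; apply/andP.
apply: measurableI; [|apply: measurableI].
- apply: borel_open; apply: open_comp; first by move=> x _; exact: head_continuous.
  exact: interval_open.
- apply: borel_closed; apply: preimage_closed; last exact: closed_ge.
  by move=> x _; exact: (continuousB (@norm2_col'_continuous x) (head_continuous lo x)).
- apply: borel_closed; apply: preimage_closed; last exact: closed_ge.
  by move=> x _; exact: (continuousB (head_continuous hi x) (@norm2_col'_continuous x)).
Qed.

Lemma shell_head_gt0 c a lo hi x : 0 <= c -> 0 < a -> shell c a lo hi x -> 0 < x 0 0.
Proof.
by move=> c0 a0 [/andP[cx _] _]; rewrite -(pmulr_rgt0 _ a0); exact: le_lt_trans cx.
Qed.

Lemma shell_norm2_lt c a lo hi (B : R) : 0 <= c -> 1 <= a -> hi <= B -> 0 <= B ->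
  shell c a lo hi `<=` [set x | norm2 x < 1 + B].
Proof.
move=> c0 a1 hiB B0 x xs; have x0 := shell_head_gt0 c0 (lt_le_trans ltr01 a1) xs.
have [/andP[_ ax1] /andP[_ xhi]] := xs.
have x1 : x 0 0 < 1 by apply: le_lt_trans ax1; rewrite ler_peMl // ltW.
have := norm2_le_head_col' x; rewrite /= gtr0_norm //.
have : hi * x 0 0 <= B by nra.
lra.
Qed.

Lemma shellS c a lo hi lo' hi' : 0 <= c -> 0 < a -> lo' <= lo -> hi <= hi' ->
  shell c a lo hi `<=` shell c a lo' hi'.
Proof.
move=> c0 a0 lo_le hi_le x xs; have x0 := shell_head_gt0 c0 a0 xs.
have [cx /andP[xlo xhi]] := xs; split=> //; apply/andP; split.
  by apply: le_trans xlo; rewrite ler_pM2r.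
by apply: le_trans xhi _; rewrite ler_pM2r.
Qed.

Lemma shell_slope_inj c a a' rho rho' x : 0 <= c -> 0 < a ->
  shell c a rho rho x -> shell c a' rho' rho' x -> rho = rho'.
Proof.
move=> c0 a0 xs [_ rho'x]; have x0 := shell_head_gt0 c0 a0 xs.
have [_ rhox] := xs; apply: (mulIf (lt0r_neq0 x0)).
by rewrite (le_anti rhox) (le_anti rho'x).
Qed.

Lemma shell_bigcap c a rho : 0 <= c -> 0 < a ->
  \bigcap_k shell c a (rho - k.+1%:R^-1) (rho + k.+1%:R^-1) = shell c a rho rho.
Proof.
move=> c0 a0; apply/seteqP; split=> [x xs|x xs k _]; last first.
  by apply: shellS xs => //; [rewrite gerBl | rewrite lerDl]; rewrite invr_ge0.
have x0 := shell_head_gt0 c0 a0 (xs 0%N Logic.I).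
have [cx _] := xs 0%N Logic.I; split=> //.
suff -> : norm2 (col' 0 x) = rho * x 0 0 by rewrite lexx.
apply/eqP; rewrite -subr_eq0 -normr_le0; set v := `|_|.
have vx (k : nat) : v * k.+1%:R <= x 0 0.
  rewrite -ler_pdivlMr // ler_norml.
  have [_ /andP[]] := xs k Logic.I.
  move: k.+1%:R^-1 => w; rewrite mulrBl mulrDl => xlo xhi.
  by apply/andP; split; lra.
rewrite leNgt; apply/negP => v0.
have := vx (Num.bound (x 0 0 / v)); rewrite leNgt; move/negP; apply.
rewrite mulrC -ltr_pdivrMr //; apply: lt_le_trans (archi_boundP _) _.
  by rewrite divr_ge0 // ltW.
by rewrite ler_nat.
Qed.

Lemma shell_setD c a lo hi rho rho' : 0 <= c -> 0 < a ->
  lo <= rho <= hi -> lo <= rho' <= hi ->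
  shell c a 0 rho `\` shell c a 0 rho' `<=` shell c a lo hi.
Proof.
move=> c0 a0 /andP[lo_rho rho_hi] /andP[lo_rho' rho'_hi] x [xs nxs].
have x0 := shell_head_gt0 c0 a0 xs; have [cx /andP[_ x_rho]] := xs.
have : ~~ (norm2 (col' 0 x) <= rho' * x 0 0).
  by apply/negP => x_rho'; apply: nxs; split=> //; rewrite mul0r norm2_ge0.
by rewrite -ltNge => x_rho'; split=> //; apply/andP; split; nra.
Qed.

Definition stretch_row (s : R) : 'rV[R]_n.+1 := \row_j if j == 0 then s ^- n else s.

Lemma det_stretch s : s != 0 -> \det (diag_mx (stretch_row s)) = 1.
Proof.
move=> s0; rewrite det_diag big_ord_recl mxE eqxx.
rewrite (eq_bigr (fun=> s)) => [|i _]; last by rewrite mxE.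
by rewrite prodr_const card_ord mulVf // expf_neq0.
Qed.

Definition stretch s (s0 : s != 0) : SL n.+1 R := SL_of (det_stretch s0).

Lemma shell_stretch s (s0 : 0 < s) c a lo hi x :
  shell c (a * s ^+ n) (lo * s ^+ n.+1) (hi * s ^+ n.+1)
    (x *m val (stretch (lt0r_neq0 s0))) <-> shell c a lo hi x.
Proof.
have sn0 : s ^+ n != 0 by rewrite expf_neq0 // lt0r_neq0.
have head_stretch : (x *m diag_mx (stretch_row s)) 0 0 = x 0 0 / s ^+ n.
  by rewrite mul_mx_diag !mxE.
have tail_stretch :
    norm2 (col' 0 (x *m diag_mx (stretch_row s))) = s * norm2 (col' 0 x).
  rewrite /norm2 -[X in _ = X * _](gtr0_norm s0) -sqrtr_sqr -sqrtrM ?sqr_ge0 //.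
  congr Num.sqrt; rewrite mulr_sumr; apply: eq_bigr => i _.
  by rewrite mxE mul_mx_diag !mxE exprMn mulrC.
have slope_stretch b : b * s ^+ n.+1 * (x 0 0 / s ^+ n) = s * (b * x 0 0).
  by rewrite exprSr; field.
rewrite /shell /mkset head_stretch tail_stretch !slope_stretch !ler_pM2l //.
by rewrite -mulrA [s ^+ n * _]mulrC divfK.
Qed.

End shell.

(** * Cut-and-project sets of random lattices *)

(* SL_d and ASL_d are treated at once through iota, which maps G to ASL_d(A). *)
Section lattice_points.
Context (R : realType) (d : nat) (H : groupType) (G : preTopologicalGroupType).
Context (f : UMagmaMorphism.type H G).
Variables (iota : G -> ASL d (adele R)) (iotaQ : H -> ASL d rat).
Hypothesis iota_continuous : continuous iota.
Hypothesis iotaM : {morph iota : x y / (x * y)%g}.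
Hypothesis iota_rat : forall h, iota (f h) = ASL_delta R (iotaQ h).
Hypothesis iota_real : forall D : SL d R, exists g, iota g = (SL_real D, 0).
Implicit Types (q : 'rV[rat]_d) (M : G) (K : set 'rV[R]_d) (W : set 'rV[fin_adele]_d).

Definition lattice_point q M : 'rV[adele R]_d := ASL_act (delta R q) (iota M).

Lemma lattice_point_continuous q : continuous (lattice_point q).
Proof.
move=> M.
exact: (continuous_comp (@iota_continuous M) (@ASL_act_continuous R d _ _)).
Qed.

Lemma lattice_point_coset h : exists2 tau : 'rV[rat]_d -> 'rV[rat]_d, bijective tau &
  forall q M, lattice_point q (f h * M)%g = lattice_point (tau q) M.
Proof.
have act1 q : ASL_act q 1%g = q by rewrite /ASL_act mulmx1 addr0.
exists (fun q => ASL_act q (iotaQ h)) => [|q M].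
  exists (fun q => ASL_act q (iotaQ h)^-1%g) => q;
    by rewrite -ASL_actM ?mulgV ?mulVg act1.
rewrite /lattice_point iotaM iota_rat ASL_actM; congr ASL_act.
by rewrite /ASL_act /delta map_mxD map_mxM.
Qed.

Lemma lattice_point_real (D : SL d R) : exists g, forall q M,
  lattice_point q (M * g)%g = lattice_point q M *m val (SL_real D).
Proof.
have [g gD] := iota_real D; exists g => q M.
by rewrite /lattice_point iotaM ASL_actM gD {1}/ASL_act addr0.
Qed.

Lemma finite_hits_near_window W (B : R) : fin_adele_bounded W ->
  finite_hits_near lattice_point (window [set x | norm2 x < B] W).
Proof.
move=> [m m0 Wm]; exists (window [set x | norm2 x < B] (frac_window d m)); split.
- apply: window_open; last exact: frac_window_open.
  apply: (@open_comp _ _ (@norm2 R d) [set t | t < B]) => [x _|]; last exact: open_lt.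
  exact: norm2_continuous.
- exact: windowS.
- by move=> M; exact: ASL_act_bounded_finite.
Qed.

Lemma card_cut_project K W M :
  (cut_project (range (lattice_point^~ M)) W `&` K #=
     hits lattice_point (window K W) M)%card.
Proof.
rewrite cut_projectE (_ : _ @` _ =
    (fun q => pi_inf (lattice_point q M)) @` hits lattice_point (window K W) M).
  by apply: inj_card_eq => q q' _ _; exact: pi_inf_ASL_act_inj.
apply/seteqP; split=> [_ [_ [[q _ <-] Wq] <-]|_ [q Wq <-]]; first by exists q.
by exists (lattice_point q M) => //; split => //; exists q.
Qed.

Lemma cut_project_count_event K W r :
  [set coset_proj f M | M in
    [set M | (cut_project (range (lattice_point^~ M)) W `&` K #= `I_r)%card]] =
  count_event lattice_point (window K W) r.
Proof.
rewrite (count_eventE lattice_point_coset); congr image.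
by apply/funext => M; rewrite /mkset (card_eql (card_cut_project K W M)).
Qed.

End lattice_points.

Section cone_count.
Context (R : realType) (n : nat) (H : groupType) (G : preTopologicalGroupType).
Context (f : UMagmaMorphism.type H G).
Variables (iota : G -> ASL n.+1 (adele R)) (iotaQ : H -> ASL n.+1 rat).
Hypothesis iota_continuous : continuous iota.
Hypothesis iotaM : {morph iota : x y / (x * y)%g}.
Hypothesis iota_rat : forall h, iota (f h) = ASL_delta R (iotaQ h).
Hypothesis iota_real : forall D : SL n.+1 R, exists g, iota g = (SL_real D, 0).
Variable mu : probability (borel (coset_space f)) R.
Variables (W : set 'rV[fin_adele]_n.+1) (c : R).
Hypothesis mu_inv : right_invariant mu.
Hypothesis W_measurable : measurable (W : set (borel 'rV[fin_adele]_n.+1)).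
Hypothesis W_bounded : fin_adele_bounded W.
Hypothesis c_ge0 : 0 <= c.

Local Notation pt := (lattice_point iota).
Let pt_continuous (q : 'rV[rat]_n.+1) : continuous (pt q) :=
  @lattice_point_continuous _ _ _ _ iota_continuous q.
Let pt_coset (h : H) : exists2 tau : 'rV[rat]_n.+1 -> 'rV[rat]_n.+1, bijective tau &
    forall q M, pt q (f h * M)%g = pt (tau q) M :=
  lattice_point_coset iotaM iota_rat h.

Definition shell_window (a lo hi : R) : set (borel 'rV[adele R]_n.+1) :=
  window (shell c a lo hi) W.

Lemma measurable_shell_window a lo hi : measurable (shell_window a lo hi).
Proof. exact: measurable_window (measurable_shell c a lo hi) W_measurable. Qed.

Lemma shell_window_sub a lo hi B : 1 <= a -> hi <= B -> 0 <= B ->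
  shell_window a lo hi `<=` window [set x | norm2 x < 1 + B] W.
Proof. by move=> a1 hiB B0; apply: windowS => //; exact: shell_norm2_lt. Qed.

Lemma finite_hits_near_shell_window a lo hi : 1 <= a ->
  finite_hits_near pt (shell_window a lo hi).
Proof.
move=> a1; apply: finite_hits_near_sub (finite_hits_near_window iota _ W_bounded).
by apply: (shell_window_sub (B := `|hi|)) => //; exact: ler_norm.
Qed.

Lemma shell_window_stretch s (s0 : 0 < s) a lo hi x :
  shell_window (a * s ^+ n) (lo * s ^+ n.+1) (hi * s ^+ n.+1)
    (x *m val (SL_real (stretch n (lt0r_neq0 s0)))) <-> shell_window a lo hi x.
Proof.
rewrite /shell_window /window /mkset pi_inf_SL_real pi_int_SL_real.
by split=> -[xs xW]; split=> //; move: xs => /shell_stretch.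
Qed.

Lemma shell_window_setD a lo hi rho rho' : 0 < a ->
  lo <= rho <= hi -> lo <= rho' <= hi ->
  shell_window a 0 rho `\` shell_window a 0 rho' `<=` shell_window a lo hi.
Proof.
move=> a0 rho_in rho'_in x [[x_rho xW] nx]; split=> //.
by apply: (shell_setD c_ge0 a0 rho_in rho'_in); split=> // x_rho'; apply: nx.
Qed.

Lemma shell_window_bigcap a rho : 0 < a ->
  \bigcap_k shell_window a (rho - k.+1%:R^-1) (rho + k.+1%:R^-1) =
  shell_window a rho rho.
Proof.
move=> a0; rewrite /shell_window -(shell_bigcap n rho c_ge0 a0).
apply/seteqP; split=> [x xw|x [xw xW] k _]; last by split=> //; exact: xw.
by split=> [k _|]; [have [] := xw k Logic.I | have [] := xw 0%N Logic.I].
Qed.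

(* The images of the lateral surface of the cone under stretchings by distinct
   factors in [1, 2] have distinct slopes, and lie in a common bounded set. *)
Lemma cone_surface_null (rho : R) : 0 < rho ->
  mu (hit_event pt (shell_window 1 rho rho)) = 0%E.
Proof.
move=> rho0; pose s k : R := 1 + k.+1%:R^-1.
have s1 k : 1 <= s k by rewrite lerDl invr_ge0.
have s2 k : s k <= 2 by rewrite /s -[2]/(1 + 1) lerD2l invf_le1 // ler1n.
have s0 k : 0 < s k := lt_le_trans ltr01 (s1 k).
have s_inj : injective s by move=> j k /addrI/invr_inj/eqP; rewrite eqr_nat => /eqP[].
pose E k := shell_window (1 * s k ^+ n) (rho * s k ^+ n.+1) (rho * s k ^+ n.+1).
have sn1 k : 1 <= 1 * s k ^+ n by rewrite mul1r exprn_ege1.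
apply: (@wandering_hit_null _ _ _ _ _ _ pt pt_continuous pt_coset mu E).
- by move=> k; exact: measurable_shell_window.
- apply/trivIsetP => j k _ _ jk; rewrite -subset0 => x [[xj _] [xk _]].
  move: jk; rewrite -(inj_eq s_inj) -(eqrXn2 (n := n.+1)) ?(ltW (s0 _)) //.
  rewrite -(inj_eq (mulfI (lt0r_neq0 rho0))) => /eqP; apply.
  by apply: (shell_slope_inj c_ge0 _ xj xk); rewrite mul1r exprn_gt0.
- have B0 : 0 <= rho * 2 ^+ n.+1 by rewrite mulr_ge0 ?exprn_ge0 // ltW.
  apply: finite_hits_near_sub
    (finite_hits_near_window iota (1 + rho * 2 ^+ n.+1) W_bounded).
  apply: bigcup_sub => k _; apply: shell_window_sub => //.
  by rewrite ler_pM2l // lerXn2r // nnegrE // ltW.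
move=> k.
have [g gE] := lattice_point_real iotaM iota_real (stretch n (lt0r_neq0 (s0 k))).
apply: (hit_event_translate pt_continuous pt_coset mu_inv (g := g)).
- exact: measurable_shell_window.
- exact: finite_hits_near_shell_window.
- by move=> q M; rewrite gE; exact: shell_window_stretch.
Qed.

Lemma cone_count_continuous (rho : R) r : 0 < rho ->
  {for rho, continuous (fun t => fine (mu (count_event pt (shell_window 1 0 t) r)))}.
Proof.
move=> rho0; pose w k : R := k.+1%:R^-1.
apply: (@count_event_continuous _ _ _ _ _ _ pt pt_continuous pt_coset mu _
  (shell_window 1 0) rho (fun k => shell_window 1 (rho - w k) (rho + w k))).
- by move=> t; exact: measurable_shell_window.
- by move=> t; exact: finite_hits_near_shell_window.
- by move=> k; exact: measurable_shell_window.
- move=> j k jk; apply/subsetPset; apply: windowS => //.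
  have wkj : w k <= w j by rewrite lef_pV2 ?posrE // ler_nat.
  by apply: shellS; rewrite // ?lerD2l ?lerN2.
- exact: finite_hits_near_shell_window.
- move=> k; have w0 : 0 < w k by rewrite invr_gt0.
  have : \forall t \near rho, `|rho - t| <= w k.
    by have /cvgrPdist_le/(_ _ w0) := @cvg_id _ (nbhs rho).
  apply: filterS => t; rewrite ler_norml => /andP[tlo thi].
  have rho_w : rho - w k <= rho <= rho + w k by apply/andP; split; lra.
  have t_w : rho - w k <= t <= rho + w k by apply/andP; split; lra.
  by rewrite subUset; split; exact: shell_window_setD.
by rewrite shell_window_bigcap //; exact: cone_surface_null.
Qed.

End cone_count.

Lemma pair_cst_continuous (S T : topologicalType) (t : T) :
  continuous (fun x : S => (x, t)).
Proof. by move=> x; apply: cvg_pair; [exact: cvg_id | exact: cvg_cst]. Qed.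

Section count_continuous.
Variables (R : realType) (n : nat) (W : set 'rV[fin_adele]_n.+1) (c : R) (r : nat).
Hypothesis W_measurable : measurable (W : set (borel 'rV[fin_adele]_n.+1)).
Hypothesis W_bounded : fin_adele_bounded W.
Hypothesis c_ge0 : 0 <= c.

Lemma ASL_count_continuous (mu : probability (borel (ASL_space R n.+1)) R) (rho : R) :
  right_invariant mu -> 0 < rho ->
  {for rho, continuous (fun t => fine (mu (ASL_count W (shell c 1 0 t) r)))}.
Proof.
move=> mu_inv rho0.
rewrite (_ : (fun t => _) = fun t => fine (mu (count_event (f := @ASL_delta R n.+1)
    (lattice_point id) (shell_window W c 1 0 t) r))).
  apply: (@cone_count_continuous _ _ _ _ _ id id) => // [M|D]; first exact: cvg_id.
  by exists (SL_real D, 0).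
apply/funext => t; congr (fine (mu _)).
exact: (@cut_project_count_event _ _ _ _ _ id id).
Qed.

Lemma SL_count_continuous (mu : probability (borel (SL_space R n.+1)) R) (rho : R) :
  right_invariant mu -> 0 < rho ->
  {for rho, continuous (fun t => fine (mu (SL_count W (shell c 1 0 t) r)))}.
Proof.
move=> mu_inv rho0.
pose iota (M : SL n.+1 (adele R)) : ASL n.+1 (adele R) := (M, 0).
pose iotaQ (h : SL n.+1 rat) : ASL n.+1 rat := (h, 0).
have iotaM : {morph iota : x y / (x * y)%g}.
  by move=> x y; congr pair; rewrite /ASL_act mul0mx addr0.
have iota_rat h : iota (@SL_delta R n.+1 h) = ASL_delta R (iotaQ h).
  by congr pair; rewrite /delta map_mx0.
rewrite (_ : (fun t => _) = fun t => fine (mu (count_event (f := @SL_delta R n.+1)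
    (lattice_point iota) (shell_window W c 1 0 t) r))).
  apply: (@cone_count_continuous _ _ _ _ _ iota iotaQ) => // [|D].
    exact: (@pair_cst_continuous (SL n.+1 (adele R)) 'rV[adele R]_n.+1 0).
  by exists (SL_real D).
apply/funext => t; congr (fine (mu _)).
rewrite -(cut_project_count_event iotaM iota_rat); congr image; apply/funext => M.
rewrite /mkset /SL_lattice; congr (cut_project _ W `&` _ #= `I_r)%card.
by congr image; apply/funext => q; rewrite /lattice_point /ASL_act addr0.
Qed.

End count_continuous.

Lemma vol_ge0 (R : realType) n (S : set 'rV[R]_n) : (0 <= vol S)%E.
Proof.
apply: le_ereal_inf_tmp => _ [F _ <-]; apply: nneseries_ge0 => k _ _.
by rewrite lee_fin; apply: prodr_ge0 => i _; rewrite le_max lexx.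
Qed.

(* kappa may be 0, since division by 0 and [fine +oo] both yield 0. *)
Lemma cone_shell (R : realType) (n : nat) (w c : R) : 0 <= w -> 0 <= c < 1 ->
  exists2 kappa, 0 <= kappa &
    forall sigma, @cone R n w c sigma = shell c 1 0 ((sigma * kappa) `^ (n.+1%:R)^-1).
Proof.
move=> w0 /andP[c0 c1].
exists (n.+2%:R / ((1 - c ^+ n.+2) * w * fine (vol (@unit_ball R n.+1)))) => [|sigma].
  by rewrite divr_ge0 // !mulr_ge0 ?fine_ge0 ?vol_ge0 // subr_ge0 exprn_ile1 // ltW.
by rewrite mulrA; apply/funext => x; rewrite /cone /shell /mkset mul1r mul0r norm2_ge0.
Qed.

Lemma powR_continuous (R : realType) (y x : R) : 0 < x ->
  {for x, continuous (fun t => t `^ y)}.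
Proof.
move=> x0; apply: differentiable_continuous; apply/derivable1_diffP.
by apply: derivable_powR; rewrite in_itv /= x0.
Qed.

Lemma continuous_comp_powRM (R : realType) (F : R -> R) (kappa y sigma : R) :
  0 <= kappa -> 0 < sigma ->
  (forall rho, 0 < rho -> {for rho, continuous F}) ->
  {for sigma, continuous (fun t : R => F ((t * kappa) `^ y))}.
Proof.
rewrite le_eqVlt => /predU1P[<- _ _|kappa0 sigma0 Fc].
  rewrite (_ : (fun t => _) = cst (F (0 `^ y))); first exact: cvg_cst.
  by apply/funext => t; rewrite mulr0.
have sk0 : 0 < sigma * kappa by rewrite mulr_gt0.
have slope := continuous_comp (@mulrr_continuous _ kappa sigma)
  (@powR_continuous R y _ sk0).
exact: (continuous_comp slope (Fc _ (powR_gt0 y sk0))).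
Qed.

Lemma measurable_shifted_window (R : realType) d (A : SL d fin_adele)
    (W : set 'rV[fin_adele]_d) (beta : 'rV[adele R]_d) :
  measurable (W : set (borel 'rV[fin_adele]_d)) ->
  measurable (shifted_window A W beta : set (borel 'rV[fin_adele]_d)).
Proof.
move=> mW; pose v := pi_int beta *m val A.
rewrite (_ : shifted_window A W beta = (fun x => x + v) @^-1` W).
  by apply: borel_preimage mW; exact: mx_translate_continuous.
apply/seteqP; split=> [_ [x Wx <-]|x Wx] /=; first by rewrite subrK.
by exists (x + v) => //; rewrite addrK.
Qed.

Theorem theorem10p2 (R : realType) (n : nat)
    (mf : {measure set (borel 'rV[fin_adele]_n.+2) -> \bar R})
    (muSL : probability (borel (SL_space R n.+2)) R)
    (muASL : probability (borel (ASL_space R n.+2)) R)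
    (A : SL n.+2 fin_adele) (W : set 'rV[fin_adele]_n.+2)
    (alpha : 'rV[R]_n.+2) (c : R) :
  normalized_haar mf ->
  right_invariant muSL ->
  right_invariant muASL ->
  compact (closure W) ->
  measurable (W : set (borel 'rV[fin_adele]_n.+2)) ->
  mf (boundary W) = 0%E ->
  (0 < mf W)%E ->
  0 <= c < 1 ->
  forall r : nat,
    {within `]0, +oo[, continuous
      (fun sigma : R => Gfun mf muSL muASL A W alpha c sigma r)}.
Proof.
move=> _ invSL invASL cW mW _ _ c01 r; have /andP[c0 _] := c01.
have [m m0 /(subset_trans (@subset_closure _ W)) Wm] := compact_fin_adele_bounded cW.
have bW : fin_adele_bounded W by exists m.
apply: continuous_in_subspaceT => sigma; rewrite inE /= in_itv /= andbT => sigma0.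
have mfW0 : 0 <= fine (mf W) by exact: fine_ge0.
have [kappa kappa0 coneE] := @cone_shell R n _ c mfW0 c01.
rewrite /Gfun; case: pselect => [alphaQ|_]; under eq_fun do rewrite coneE.
  apply: (@continuous_comp_powRM R (fun rho => fine (muSL (SL_count
    (shifted_window A W (sval (cid2 alphaQ))) (shell c 1 0 rho) r)))) => // rho.
  apply: SL_count_continuous => //; first exact: measurable_shifted_window.
  exact: fin_adele_bounded_translate.
apply: (@continuous_comp_powRM R (fun rho =>
  fine (muASL (ASL_count W (shell c 1 0 rho) r)))) => // rho.
exact: ASL_count_continuous.
Qed.
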